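(* The variety $\mathbb{CMG}_\sim$ is generated as a quasivariety by its finite functional monadic $G_\sim$-algebras with a fixed point (an element $d$ with $d=\sim d$).
   Context: A Gödel algebra is a Heyting algebra $\langle A,\vee,\wedge,\to,0,1\rangle$ satisfying $(x\to y)\vee(y\to x)\approx 1$; put $\neg x:=x\to 0$. A De Morgan algebra is a bounded distributive lattice with a unary operation $\sim$ satisfying $\sim\sim x\approx x$ and $\sim(x\wedge y)\approx \sim x\vee\sim y$. A $G_\sim$-algebra $\langle \mathbf A,\sim\rangle$ is a Gödel algebra $\mathbf A$ with a unary operation $\sim$ that makes its bounded lattice reduct a De Morgan algebra and satisfies $\neg x\le\sim x$. An $MG_\sim$-algebra is an algebra $\langle A,\vee,\wedge,\to,\sim,\exists,\forall,0,1\rangle$ such that $\langle \mathbf A,\sim\rangle$ is a $G_\sim$-algebra and: (M1) $\forall x\to x\approx 1$; (M2) $\forall(x\to\forall y)\approx\exists x\to\forall y$; (M3) $\forall(\forall x\to y)\approx\forall x\to\forall y$; (M4) $\forall(\exists x\vee y)\approx\exists x\vee\forall y$; (Q) $\forall x\approx\ \sim\exists\sim x$. $\mathbb{CMG}_\sim$ is the variety of $MG_\sim$-algebras satisfying (C): $\exists(x\wedge\sim x)\le\forall(x\vee\sim x)$. Functional monadic $G_\sim$-algebras: let $\langle\mathbf A,\sim\rangle$ be a totally ordered $G_\sim$-algebra and $X$ a nonempty set, and let $\langle \mathbf A^X,\sim\rangle$ be the power $G_\sim$-algebra with pointwise operations. Let $S$ be the set of $f\in A^X$ for which $\inf\{f(x):x\in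 X\}$ and $\sup\{f(x):x\in X\}$ both exist in $\mathbf A$. For $f\in S$ let $\forall_\wedge f$ and $\exists_\vee f$ be the constant functions with values $\inf\{f(y):y\in X\}$ and $\sup\{f(y):y\in X\}$, respectively. A functional monadic $G_\sim$-algebra is any algebra $\langle\mathbf B,\sim,\exists_\vee,\forall_\wedge\rangle$ where $\langle\mathbf B,\sim\rangle$ is a subalgebra of such an $\langle\mathbf A^X,\sim\rangle$ with $B\subseteq S$ and $B$ closed under $\exists_\vee$ and $\forall_\wedge$. Every such algebra belongs to $\mathbb{CMG}_\sim$. A class $\mathcal V$ is generated as a quasivariety by $\mathcal K\subseteq\mathcal V$ if $\mathcal V$ is the class of all algebras (of the given type) satisfying every quasi-identity that holds in all members of $\mathcal K$. *)

(* Defs.v *)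
From Stdlib Require Import List FinFun.

(** * Algebras *)

(** Algebras of type (join, meet, ->, ~, 0, 1), with no law imposed. *)
Record gs_algebra : Type := GsAlgebra {
  carrier :> Type;
  join : carrier -> carrier -> carrier;
  meet : carrier -> carrier -> carrier;
  imp : carrier -> carrier -> carrier;
  inv : carrier -> carrier;
  bot : carrier;
  top : carrier
}.

Arguments join {_} _ _.
Arguments meet {_} _ _.
Arguments imp {_} _ _.
Arguments inv {_} _.
Arguments bot {_}.
Arguments top {_}.

(** Algebras of the full type, with no law imposed. *)
Record mgs_algebra : Type := MgsAlgebra {
  reduct :> gs_algebra;
  ex : reduct -> reduct;
  all : reduct -> reduct
}.

Arguments ex {_} _.
Arguments all {_} _.

Declare Scope mgs_scope.
Notation "x ⊔ y" := (join x y) (at level 50, left associativity) : mgs_scope.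
Notation "x ⊓ y" := (meet x y) (at level 40, left associativity) : mgs_scope.
Notation "x ⇒ y" := (imp x y) (at level 55, right associativity) : mgs_scope.
Open Scope mgs_scope.

Section Laws.
Variable A : gs_algebra.
Implicit Types x y z : A.

Definition le x y : Prop := x ⊓ y = x.

Definition neg x : A := x ⇒ bot.

Record is_lattice : Prop := {
  joinC : forall x y, x ⊔ y = y ⊔ x;
  meetC : forall x y, x ⊓ y = y ⊓ x;
  joinA : forall x y z, x ⊔ (y ⊔ z) = (x ⊔ y) ⊔ z;
  meetA : forall x y z, x ⊓ (y ⊓ z) = (x ⊓ y) ⊓ z;
  joinK : forall x y, x ⊓ (x ⊔ y) = x;
  meetK : forall x y, x ⊔ (x ⊓ y) = x
}.

Record is_bounded_lattice : Prop := {
  bounded_lattice : is_lattice;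
  bot_le : forall x, le bot x;
  le_top : forall x, le x top
}.

Record is_heyting : Prop := {
  heyting_lattice : is_bounded_lattice;
  residuation : forall x y z, le (x ⊓ y) z <-> le x (y ⇒ z)
}.

Record is_godel : Prop := {
  godel_heyting : is_heyting;
  prelinearity : forall x y, (x ⇒ y) ⊔ (y ⇒ x) = top
}.

Record is_de_morgan : Prop := {
  de_morgan_lattice : is_bounded_lattice;
  meet_joinDr : forall x y z, x ⊓ (y ⊔ z) = (x ⊓ y) ⊔ (x ⊓ z);
  invK : forall x, inv (inv x) = x;
  inv_meet : forall x y, inv (x ⊓ y) = inv x ⊔ inv y
}.

Record is_gs : Prop := {
  gs_godel : is_godel;
  gs_de_morgan : is_de_morgan;
  neg_le_inv : forall x, le (neg x) (inv x)
}.

Definition totally_ordered : Prop := forall x y, le x y \/ le y x.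

Definition is_inf (X : Type) (f : X -> A) (a : A) : Prop :=
  (forall i, le a (f i)) /\ (forall b, (forall i, le b (f i)) -> le b a).

Definition is_sup (X : Type) (f : X -> A) (a : A) : Prop :=
  (forall i, le (f i) a) /\ (forall b, (forall i, le (f i) b) -> le a b).

Record subuniverse (B : A -> Prop) : Prop := {
  sub_join : forall x y, B x -> B y -> B (x ⊔ y);
  sub_meet : forall x y, B x -> B y -> B (x ⊓ y);
  sub_imp : forall x y, B x -> B y -> B (x ⇒ y);
  sub_inv : forall x, B x -> B (inv x);
  sub_bot : B bot;
  sub_top : B top
}.

End Laws.

Arguments le {A} _ _.
Arguments neg {A} _.
Arguments is_inf {A X} _ _.
Arguments is_sup {A X} _ _.
Arguments subuniverse {A} _.
Arguments sub_join {A B} _ {x y} _ _.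
Arguments sub_meet {A B} _ {x y} _ _.
Arguments sub_imp {A B} _ {x y} _ _.
Arguments sub_inv {A B} _ {x} _.
Arguments sub_bot {A B} _.
Arguments sub_top {A B} _.

Record is_mgs (M : mgs_algebra) : Prop := {
  mgs_gs : is_gs M;
  M1 : forall x : M, all x ⇒ x = top;
  M2 : forall x y : M, all (x ⇒ all y) = (ex x ⇒ all y);
  M3 : forall x y : M, all (all x ⇒ y) = (all x ⇒ all y);
  M4 : forall x y : M, all (ex x ⊔ y) = ex x ⊔ all y;
  MQ : forall x : M, all x = inv (ex (inv x))
}.

Record is_cmgs (M : mgs_algebra) : Prop := {
  cmgs_mgs : is_mgs M;
  MC : forall x : M, le (ex (x ⊓ inv x)) (all (x ⊔ inv x))
}.

(** * Functional monadic algebras *)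

Definition power (A : gs_algebra) (X : Type) : gs_algebra := {|
  carrier := X -> A;
  join := fun f g i => f i ⊔ g i;
  meet := fun f g i => f i ⊓ g i;
  imp := fun f g i => f i ⇒ g i;
  inv := fun f i => inv (f i);
  bot := fun _ => bot;
  top := fun _ => top
|}.

Definition subalgebra (A : gs_algebra) (B : A -> Prop) (subB : subuniverse B) :
    gs_algebra := {|
  carrier := {x : A | B x};
  join := fun x y =>
    exist B _ (sub_join subB (proj2_sig x) (proj2_sig y));
  meet := fun x y =>
    exist B _ (sub_meet subB (proj2_sig x) (proj2_sig y));
  imp := fun x y =>
    exist B _ (sub_imp subB (proj2_sig x) (proj2_sig y));
  inv := fun x => exist B _ (sub_inv subB (proj2_sig x));
  bot := exist B _ (sub_bot subB);
  top := exist B _ (sub_top subB)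
|}.

Arguments subalgebra {A B} subB.

(** The quantifiers are given as operations [exB] and [allB] on the subuniverse
    [B] of [A^X], and the last two hypotheses say that they are the partial
    operations of supremum and infimum on [A^X].  That they are total on [B]
    and take values in [B] expresses both that every member of [B] has an
    infimum and a supremum and that [B] is closed under the quantifiers. *)
Inductive is_functional : mgs_algebra -> Prop :=
| Functional (A : gs_algebra) (X : Type) (B : power A X -> Prop)
    (subB : subuniverse B) (exB allB : subalgebra subB -> subalgebra subB) :
    is_gs A -> totally_ordered A -> inhabited X ->
    (forall f, exists a, is_sup (proj1_sig f) a /\
       proj1_sig (exB f) = (fun _ => a)) ->
    (forall f, exists a, is_inf (proj1_sig f) a /\
       proj1_sig (allB f) = (fun _ => a)) ->
    is_functional (MgsAlgebra (subalgebra subB) exB allB).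

Definition has_fixed_point (M : mgs_algebra) : Prop :=
  exists d : M, d = inv d.

(** * Quasi-identities *)

Inductive term : Type :=
| Var (n : nat)
| Join (s t : term)
| Meet (s t : term)
| Imp (s t : term)
| Inv (t : term)
| Ex (t : term)
| All (t : term)
| Bot
| Top.

Fixpoint eval (M : mgs_algebra) (v : nat -> M) (t : term) : M :=
  match t with
  | Var n => v n
  | Join s t => eval M v s ⊔ eval M v t
  | Meet s t => eval M v s ⊓ eval M v t
  | Imp s t => eval M v s ⇒ eval M v t
  | Inv t => inv (eval M v t)
  | Ex t => ex (eval M v t)
  | All t => all (eval M v t)
  | Bot => bot
  | Top => top
  end.

Definition identity : Type := (term * term)%type.

Record quasi_identity : Type := QuasiIdentity {
  premises : list identity;
  conclusion : identity
}.

Definition holds_at (M : mgs_algebra) (v : nat -> M) (e : identity) : Prop :=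
  eval M v (fst e) = eval M v (snd e).

Definition satisfies (M : mgs_algebra) (q : quasi_identity) : Prop :=
  forall v : nat -> M,
    (forall e, In e (premises q) -> holds_at M v e) ->
    holds_at M v (conclusion q).

Definition generated_as_quasivariety_by (V K : mgs_algebra -> Prop) : Prop :=
  (forall M, K M -> V M) /\
  (forall M, V M <->
     (forall q, (forall N, K N -> satisfies N q) -> satisfies M q)).

(* Main.v *)
From Stdlib Require Import FinFun List Permutation ZArith Lia.
From Stdlib Require Import ClassicalEpsilon FunctionalExtensionality ProofIrrelevance.
Require Import Defs.
Import ListNotations.

(** Let a quasi-identity fail in [M].  Only the finite set [V] of values of its
    subterms matters, and no prime filters are needed: a nonzero complemented
    element [b] that settles all comparisons in [V] turns [V] into a totally
    preordered set, [x] being below [y] when [b ⊓ x] is below [y].  First such an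
    element [u] is chosen among the quantified elements, which makes the
    quantified elements of [V] a chain of levels; then finitely many [b] below
    [u] are chosen that witness every failure of [k <= all x] at [u], and the
    failure of the conclusion.

    Each such [b] is a place of the functional algebra.  The chain of truth
    values has the levels and, in each gap between consecutive levels, a copy of
    [Z].  At the place [(b, j)] an element of [V] lying in a gap is moved [j]
    steps outwards from the centre, so that over all [j] its infimum and supremum
    are the levels enclosing the gap, which is what the quantifiers of [M]
    prescribe.  A fixed point may be added as a level: by axiom (C), if [x] lies
    above it at every place, then so does [all x]. *)

(** * Order in Gödel algebras with an involution *)

(** Over finitely many places an infimum in a chain is attained, whereas [all x] may lie strictly
    below [x] at each of them. This is why every gap is infinite and every place is repeated for all
    integers [j]. The functional algebra is finite all the same: a member is determined by its
    values at [j = 0], and their heights inside the gaps stay bounded, because an operation on a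
    chain returns an argument, the involute of one, or a level.

    One list of levels serves all places, since [u] settles the comparisons of quantified elements
    and every place is a nonzero element below [u].

    Complemented elements can stand in for prime filters because of the operator [delta]: below a
    complemented element, a comparison holds exactly when that element lies below the complemented
    element [delta (x ⇒ y)]; otherwise a nonzero part remains on which it fails for good. *)

Section GsOrder.
Variable A : gs_algebra.
Hypothesis gsA : is_gs A.
Implicit Types x y z b : A.

Let godelA := gs_godel A gsA.
Let heytingA := godel_heyting A godelA.
Let boundedA := heyting_lattice A heytingA.
Let latticeA := bounded_lattice A boundedA.
Let deMorganA := gs_de_morgan A gsA.

Lemma meet_idem x : x ⊓ x = x.
Proof.
  rewrite <- (meetK A latticeA x x) at 2. apply (joinK A latticeA).
Qed.

Lemma le_refl x : le x x.
Proof. apply meet_idem. Qed.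

Lemma le_trans x y z : le x y -> le y z -> le x z.
Proof.
  unfold le. intros Hxy Hyz. rewrite <- Hxy at 1.
  now rewrite <- (meetA A latticeA), Hyz.
Qed.

Lemma le_antisym x y : le x y -> le y x -> x = y.
Proof.
  unfold le. intros Hxy Hyx. rewrite <- Hxy, (meetC A latticeA). exact Hyx.
Qed.

Lemma meet_le_l x y : le (x ⊓ y) x.
Proof.
  unfold le. rewrite (meetC A latticeA), (meetA A latticeA). now rewrite meet_idem.
Qed.

Lemma meet_le_r x y : le (x ⊓ y) y.
Proof. rewrite (meetC A latticeA). apply meet_le_l. Qed.

Lemma le_meet x y z : le z x -> le z y -> le z (x ⊓ y).
Proof.
  unfold le. intros Hx Hy. now rewrite (meetA A latticeA), Hx.
Qed.

Lemma le_join_l x y : le x (x ⊔ y).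
Proof. apply (joinK A latticeA). Qed.

Lemma le_join_r x y : le y (x ⊔ y).
Proof. rewrite (joinC A latticeA). apply le_join_l. Qed.

Lemma le_iff_join x y : le x y <-> x ⊔ y = y.
Proof.
  split; intros H.
  - rewrite <- H, (meetC A latticeA), (joinC A latticeA). apply (meetK A latticeA).
  - rewrite <- H. apply le_join_l.
Qed.

Lemma join_le x y z : le x z -> le y z -> le (x ⊔ y) z.
Proof.
  rewrite !le_iff_join. intros Hx Hy. now rewrite <- (joinA A latticeA), Hy.
Qed.

Lemma bot_min x : le bot x.
Proof. apply (bot_le A boundedA). Qed.

Lemma top_max x : le x top.
Proof. apply (le_top A boundedA). Qed.

Lemma le_imp x y z : le (x ⊓ y) z <-> le x (y ⇒ z).
Proof. apply (residuation A heytingA). Qed.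

Lemma le_meet_imp x y z : le x y -> le x (y ⇒ z) -> le x z.
Proof.
  intros H1 H2. apply le_trans with (x ⊓ y).
  - apply le_meet; auto using le_refl.
  - now apply le_imp.
Qed.

Lemma imp_eq_top x y : (x ⇒ y) = top <-> le x y.
Proof.
  split; intros H.
  - apply le_meet_imp with x; [apply le_refl|]. rewrite H. apply top_max.
  - apply le_antisym; [apply top_max|]. apply le_imp.
    apply le_trans with x; [apply meet_le_r | exact H].
Qed.

Lemma meet_comm x y : x ⊓ y = y ⊓ x.
Proof. apply (meetC A latticeA). Qed.

Lemma join_comm x y : x ⊔ y = y ⊔ x.
Proof. apply (joinC A latticeA). Qed.

Lemma le_bot x : le x bot -> x = bot.
Proof. intros H. apply le_antisym; auto using bot_min. Qed.

Lemma top_le x : le top x -> x = top.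
Proof. intros H. apply le_antisym; auto using top_max. Qed.

Lemma invI x : inv (inv x) = x.
Proof. apply (invK A deMorganA). Qed.

Lemma inv_anti x y : le x y -> le (inv y) (inv x).
Proof.
  intros H. apply le_iff_join.
  rewrite <- (inv_meet A deMorganA), (meetC A latticeA). now rewrite H.
Qed.

Lemma inv_le x y : le (inv x) y -> le (inv y) x.
Proof. intros H. apply inv_anti in H. now rewrite invI in H. Qed.

Lemma le_inv x y : le x (inv y) -> le y (inv x).
Proof. intros H. apply inv_anti in H. now rewrite invI in H. Qed.

Lemma inv_join x y : inv (x ⊔ y) = inv x ⊓ inv y.
Proof.
  rewrite <- (invI (inv x ⊓ inv y)), (inv_meet A deMorganA). now rewrite !invI.
Qed.

Lemma inv_top : inv top = bot :> A.
Proof. apply le_bot, inv_le, top_max. Qed.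

Lemma neg_inv x : le (neg x) (inv x).
Proof. apply (neg_le_inv A gsA). Qed.

Lemma le_neg x y : le x (neg y) <-> le (x ⊓ y) bot.
Proof. symmetry. apply le_imp. Qed.

Lemma le_neg_bot b x : le b x -> le b (neg x) -> b = bot.
Proof. intros H1 H2. apply le_bot. now apply le_meet_imp with x. Qed.

Lemma neg_anti x y : le x y -> le (neg y) (neg x).
Proof.
  intros H. apply le_neg. apply le_meet_imp with y.
  - eapply le_trans; [apply meet_le_r | exact H].
  - apply meet_le_l.
Qed.

Lemma le_negneg x : le x (neg (neg x)).
Proof.
  apply le_neg, le_meet_imp with x; [apply meet_le_l | apply meet_le_r].
Qed.

Lemma is_inf_unique (X : Type) (f : X -> A) a a' :
  is_inf f a -> is_inf f a' -> a = a'.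
Proof. intros [H1 H2] [H1' H2']. apply le_antisym; auto. Qed.

Lemma is_sup_unique (X : Type) (f : X -> A) a a' :
  is_sup f a -> is_sup f a' -> a = a'.
Proof. intros [H1 H2] [H1' H2']. apply le_antisym; auto. Qed.

Lemma is_sup_inv (X : Type) (f : X -> A) a :
  is_inf f a -> is_sup (fun i => inv (f i)) (inv a).
Proof.
  intros [H1 H2]. split.
  - intros i. apply inv_anti, H1.
  - intros b Hb. apply inv_le, H2. intros i. apply inv_le, Hb.
Qed.

(** * Complemented elements *)

Definition complemented b : Prop := b ⊔ neg b = top.

(** On a chain this is Baaz's operator: top goes to top, every other element to bottom. In general
    it is the largest complemented element below [x]. *)
Definition delta x : A := neg (inv x).

(** Both hypotheses are residuated: [b] and [neg b] lie below [x ⇒ y], hence so does their join,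
    which is top. *)
Lemma le_split b x y :
  complemented b -> le (b ⊓ x) y -> le (neg b ⊓ x) y -> le x y.
Proof.
  intros Hb H1 H2. apply imp_eq_top, top_le. rewrite <- Hb.
  apply join_le; now apply le_imp.
Qed.

(** Stone's identity, from prelinearity of [x] and [neg x]: [x ⇒ neg x] lies below [neg x], and
    [neg x ⇒ x] below [neg (neg x)]. *)
Lemma complemented_neg x : complemented (neg x).
Proof.
  unfold complemented. apply top_le.
  rewrite <- (prelinearity A godelA x (neg x)). apply join_le.
  - eapply le_trans; [| apply le_join_l].
    apply le_neg. apply le_meet_imp with x; [apply meet_le_r|].
    apply le_meet_imp with x; [apply meet_le_r | apply meet_le_l].
  - eapply le_trans; [| apply le_join_r].
    apply le_neg. apply le_meet_imp with x; [| apply meet_le_r].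
    apply le_meet_imp with (neg x); [apply meet_le_r | apply meet_le_l].
Qed.

Lemma negneg_complemented b : complemented b -> neg (neg b) = b.
Proof.
  intros Hb. apply le_antisym; [| apply le_negneg].
  apply le_split with b; [exact Hb | apply meet_le_l |].
  eapply le_trans; [| apply bot_min].
  apply le_meet_imp with (neg b); [apply meet_le_l | apply meet_le_r].
Qed.

(** Since [b] lies below [inv (neg b)], the meet [inv b ⊓ b] lies below [inv (b ⊔ neg b)], which is
    bottom. The other inequality is an axiom. *)
Lemma inv_complemented b : complemented b -> inv b = neg b.
Proof.
  intros Hb. apply le_antisym; [| apply neg_inv].
  apply le_neg. rewrite <- inv_top, <- Hb, inv_join.
  apply le_meet; [apply meet_le_l|].
  eapply le_trans; [apply meet_le_r|].
  rewrite <- (negneg_complemented b Hb) at 1. apply neg_inv.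
Qed.

Lemma complemented_meet b c :
  complemented b -> complemented c -> complemented (b ⊓ c).
Proof.
  intros Hb Hc. apply top_le.
  apply le_split with b; [exact Hb | |].
  - apply le_split with c; [exact Hc | |].
    + eapply le_trans; [| apply le_join_l]. apply le_meet.
      * eapply le_trans; [apply meet_le_r | apply meet_le_l].
      * apply meet_le_l.
    + eapply le_trans; [| apply le_join_r].
      eapply le_trans; [apply meet_le_l | apply neg_anti, meet_le_r].
  - eapply le_trans; [| apply le_join_r].
    eapply le_trans; [apply meet_le_l | apply neg_anti, meet_le_l].
Qed.

Lemma complemented_delta x : complemented (delta x).
Proof. apply complemented_neg. Qed.

Lemma delta_le x : le (delta x) x.
Proof.
  unfold delta. eapply le_trans; [apply neg_inv|]. rewrite invI. apply le_refl.
Qed.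

(** Contraposition survives restriction to [b]: [inv (b ⊓ x)] is [neg b ⊔ inv x], and meeting with
    [b] removes [neg b]. *)
Lemma meet_inv_swap b x y :
  complemented b -> le (b ⊓ x) y -> le (b ⊓ inv y) (inv x).
Proof.
  intros Hb H. rewrite (meetC A latticeA). apply le_imp.
  apply inv_anti in H. eapply le_trans; [exact H|].
  rewrite (inv_meet A deMorganA), (inv_complemented b Hb).
  apply join_le; apply le_imp.
  - eapply le_trans; [| apply bot_min]. apply le_neg, le_refl.
  - apply meet_le_l.
Qed.

Lemma le_delta b x : complemented b -> le b x -> le b (delta x).
Proof.
  intros Hb H. apply le_neg. rewrite <- inv_top. apply meet_inv_swap; [exact Hb|].
  eapply le_trans; [apply meet_le_l | exact H].
Qed.

(** Where [x] is not top, [y] is: by De Morgan [inv x] lies below [delta y], and negating twice puts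
    [neg (delta x)] below [delta y]. *)
Lemma neg_delta_le x y : x ⊔ y = top -> le (neg (delta x)) y.
Proof.
  intros H. apply le_trans with (delta y); [| apply delta_le].
  rewrite <- (negneg_complemented (delta y)) by apply complemented_delta.
  do 2 apply neg_anti. apply le_neg. rewrite <- inv_top, <- H, inv_join.
  rewrite (meetC A latticeA). apply le_refl.
Qed.

(** On a chain [x ⇒ y] is top or [y]. This is prelinearity of [x] and [x ⇒ y], with the nested
    implications simplified. *)
Lemma prelinear_imp x y : (x ⇒ y) ⊔ ((x ⇒ y) ⇒ y) = top.
Proof.
  apply top_le. rewrite <- (prelinearity A godelA x (x ⇒ y)).
  apply join_le.
  - eapply le_trans; [| apply le_join_l]. apply le_imp.
    apply le_meet_imp with x; [apply meet_le_r|].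
    apply le_meet_imp with x; [apply meet_le_r | apply meet_le_l].
  - eapply le_trans; [| apply le_join_r]. apply le_imp.
    apply le_meet_imp with x; [| apply meet_le_r].
    apply le_meet_imp with (x ⇒ y); [apply meet_le_r | apply meet_le_l].
Qed.

(** * The preorder below a complemented element *)

Definition le_at b x y : Prop := le (b ⊓ x) y.

Lemma le_at_of_le b x y : le x y -> le_at b x y.
Proof. intros H. eapply le_trans; [apply meet_le_r | exact H]. Qed.

Lemma le_at_trans b x y z : le_at b x y -> le_at b y z -> le_at b x z.
Proof.
  unfold le_at. intros H1 H2. eapply le_trans; [| exact H2].
  apply le_meet; [apply meet_le_l | exact H1].
Qed.

Lemma le_at_imp b x y : le_at b x y <-> le b (x ⇒ y).
Proof. apply le_imp. Qed.

Lemma le_at_join b x y z : le_at b x z -> le_at b y z -> le_at b (x ⊔ y) z.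
Proof.
  unfold le_at. rewrite !(meet_comm b). intros H1 H2.
  apply le_imp. apply join_le; now apply le_imp.
Qed.

Lemma le_at_mono b b' x y : le b' b -> le_at b x y -> le_at b' x y.
Proof. rewrite !le_at_imp. apply le_trans. Qed.

(** [state b] is a stand-in for an ultrafilter of complemented elements;
    [decided] says that it settles the comparison of [x] and [y]. *)
Definition state b : Prop := complemented b /\ b <> bot.

Definition decided b x y : Prop :=
  le_at b x y \/ le b (neg (delta (x ⇒ y))).

Lemma not_le_at b x y :
  state b -> le b (neg (delta (x ⇒ y))) -> ~ le_at b x y.
Proof.
  intros [Hb Hn] H Hle. apply Hn. apply le_at_imp in Hle.
  apply le_neg_bot with (delta (x ⇒ y)); [now apply le_delta | exact H].
Qed.

(** The negative alternative is not [~ le_at], which a smaller element may violate, but lying below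
    [neg (delta (x ⇒ y))], which persists. *)
Lemma decided_mono b b' x y : le b' b -> decided b x y -> decided b' x y.
Proof.
  intros Hb [H|H]; [left | right].
  - eapply le_at_mono; eauto.
  - eapply le_trans; eauto.
Qed.

Lemma decided_total b x y : decided b x y -> le_at b x y \/ le_at b y x.
Proof.
  intros [H|H]; [now left | right]. apply le_at_imp.
  eapply le_trans; [exact H|]. apply neg_delta_le, (prelinearity A godelA).
Qed.

Lemma decided_imp b x y :
  decided b x y -> le_at b x y \/ le_at b (x ⇒ y) y.
Proof.
  intros [H|H]; [now left | right]. apply le_at_imp.
  eapply le_trans; [exact H|]. apply neg_delta_le, prelinear_imp.
Qed.

Lemma state_meet_neg b c :
  state b -> complemented c -> ~ le b c -> state (b ⊓ neg c).
Proof.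
  intros [Hb Hn] Hc H. split.
  - apply complemented_meet; [exact Hb | apply complemented_neg].
  - intros E. apply H. rewrite <- (negneg_complemented c Hc).
    apply le_neg. rewrite E. apply le_refl.
Qed.

(** [Q] is carried along so that [b'] can be kept among the quantified elements. *)
Lemma decide_pairs (Q : A -> Prop) (b : A) (ps : list (A * A)) :
  (forall x y, Q x -> Q y -> Q (x ⊓ neg (delta y))) ->
  state b -> Q b -> (forall p, In p ps -> Q (fst p ⇒ snd p)) ->
  exists b', state b' /\ Q b' /\ le b' b /\
    forall p, In p ps -> decided b' (fst p) (snd p).
Proof.
  intros HQ Sb Qb. induction ps as [|[x y] ps IH]; intros Hps.
  - exists b. repeat split; try apply Sb; auto using le_refl. intros p [].
  - destruct IH as (c & Sc & Qc & Hcb & Hc); [intros; apply Hps; now right|].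
    (* As [delta (x ⇒ y)] is complemented, [c] either lies below it or keeps a nonzero complemented
       part outside it. *)
    destruct (classic (le c (delta (x ⇒ y)))) as [H|H].
    + exists c. repeat split; try apply Sc; auto.
      intros p [<-|Hp]; auto. left. apply le_at_imp.
      eapply le_trans; [exact H | apply delta_le].
    + exists (c ⊓ neg (delta (x ⇒ y))).
      split; [apply state_meet_neg; auto using complemented_delta|].
      split; [apply HQ; [exact Qc | apply (Hps (x, y)); now left]|].
      split; [eapply le_trans; [apply meet_le_l | exact Hcb]|].
      intros p [<-|Hp]; [right; apply meet_le_r|].
      apply decided_mono with c; [apply meet_le_l | auto].
Qed.

End GsOrder.

(** * Quantifiers *)

Section Quantifiers.
Variable M : mgs_algebra.
Hypothesis mgsM : is_mgs M.
Implicit Types x y k : M.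

Let gsM := mgs_gs M mgsM.

Lemma all_le x : le (all x) x.
Proof. apply (imp_eq_top M gsM), (M1 M mgsM). Qed.

Lemma ex_all x : ex x = inv (all (inv x)).
Proof. rewrite (MQ M mgsM). now rewrite !(invI M gsM). Qed.

Lemma le_ex x : le x (ex x).
Proof.
  rewrite ex_all. apply (le_inv M gsM), all_le.
Qed.

Lemma all_bot : all bot = bot :> M.
Proof. apply (le_bot M gsM), all_le. Qed.

Lemma ex_top : ex top = top :> M.
Proof. apply (top_le M gsM), le_ex. Qed.

Lemma all_top : all top = top :> M.
Proof.
  assert (H : forall y : M, top ⊔ y = top).
  { intros y. apply (top_le M gsM), (le_join_l M gsM). }
  pose proof (M4 M mgsM top top) as H4. now rewrite ex_top, !H in H4.
Qed.

Lemma all_mono x y : le x y -> le (all x) (all y).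
Proof.
  intros H. apply (imp_eq_top M gsM). rewrite <- (M3 M mgsM).
  replace (all x ⇒ y) with (top : M); [apply all_top|].
  symmetry. apply (imp_eq_top M gsM).
  eapply (le_trans M gsM); [apply all_le | exact H].
Qed.

Lemma all_all x : all (all x) = all x.
Proof.
  apply (le_antisym M gsM); [apply all_le|].
  apply (imp_eq_top M gsM). rewrite <- (M3 M mgsM).
  rewrite (proj2 (imp_eq_top M gsM (all x) (all x)) (le_refl M gsM _)).
  apply all_top.
Qed.

Lemma join_bot x : x ⊔ bot = x.
Proof.
  apply (le_antisym M gsM); [| apply (le_join_l M gsM)].
  apply (join_le M gsM); [apply (le_refl M gsM) | apply (bot_min M gsM)].
Qed.

Lemma all_ex x : all (ex x) = ex x.
Proof.
  pose proof (M4 M mgsM x bot) as H. now rewrite all_bot, !join_bot in H.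
Qed.

Definition quantified k : Prop := all k = k.

(** By (Q), [inv (all k)] is a value of [ex], and [all] fixes such values. So both quantifiers have
    the same fixed elements. *)
Lemma quantified_ex k : quantified k -> ex k = k.
Proof.
  unfold quantified. intros H. rewrite <- H at 1.
  rewrite ex_all, (MQ M mgsM k), (invI M gsM), all_ex, <- (MQ M mgsM). exact H.
Qed.

Lemma quantified_of_ex k : ex k = k -> quantified k.
Proof. unfold quantified. intros H. rewrite <- H. apply all_ex. Qed.

Lemma quantified_all x : quantified (all x).
Proof. apply all_all. Qed.

Lemma quantified_inv k : quantified k -> quantified (inv k).
Proof.
  unfold quantified. intros H.
  rewrite (MQ M mgsM), (invI M gsM). now rewrite quantified_ex.
Qed.

Lemma quantified_imp k l : quantified k -> quantified l -> quantified (k ⇒ l).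
Proof.
  unfold quantified. intros Hk Hl. rewrite <- Hk, (M3 M mgsM). now rewrite Hl.
Qed.

Lemma quantified_neg k : quantified k -> quantified (neg k).
Proof. intros H. apply quantified_imp; [exact H | apply all_bot]. Qed.

Lemma quantified_delta k : quantified k -> quantified (delta M k).
Proof. intros H. now apply quantified_neg, quantified_inv. Qed.

Lemma quantified_meet k l : quantified k -> quantified l -> quantified (k ⊓ l).
Proof.
  intros Hk Hl. apply quantified_of_ex.
  apply (le_antisym M gsM); [| apply le_ex].
  assert (ex_mono : forall x y, le x y -> le (ex x) (ex y)).
  { intros x y H. rewrite !ex_all.
    now apply (inv_anti M gsM), all_mono, (inv_anti M gsM). }
  apply (le_meet M gsM).
  - rewrite <- (quantified_ex k Hk) at 2. apply ex_mono, (meet_le_l M gsM).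
  - rewrite <- (quantified_ex l Hl) at 2. apply ex_mono, (meet_le_r M gsM).
Qed.

Lemma all_imp k x : quantified k -> all (k ⇒ x) = k ⇒ all x.
Proof. unfold quantified. intros H. rewrite <- H at 1. rewrite (M3 M mgsM). now rewrite H. Qed.

(** This is axiom (C) for [x ⊔ neg u]. *)
Lemma all_above_inv u x :
  le (ex ((x ⊔ neg u) ⊓ inv (x ⊔ neg u))) (all ((x ⊔ neg u) ⊔ inv (x ⊔ neg u))) ->
  complemented M u -> quantified u ->
  le_at M u (inv x) x -> le_at M u (inv (all x)) (all x).
Proof.
  intros HC Cu Qu H. set (y := x ⊔ neg u) in *.
  assert (Ey : inv y = inv x ⊓ u).
  { unfold y. rewrite (inv_join M gsM).
    rewrite (inv_complemented M gsM (neg u)) by apply (complemented_neg M gsM).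
    now rewrite (negneg_complemented M gsM). }
  assert (Hy : le (inv y) y).
  { rewrite Ey. eapply (le_trans M gsM); [| apply (le_join_l M gsM)].
    eapply (le_trans M gsM); [| exact H].
    apply (le_meet M gsM); [apply (meet_le_r M gsM) | apply (meet_le_l M gsM)]. }
  assert (E1 : y ⊓ inv y = inv y).
  { apply (le_antisym M gsM); [apply (meet_le_r M gsM)|].
    apply (le_meet M gsM); [exact Hy | apply (le_refl M gsM)]. }
  assert (E2 : y ⊔ inv y = y).
  { apply (le_antisym M gsM); [| apply (le_join_l M gsM)].
    apply (join_le M gsM); [apply (le_refl M gsM) | exact Hy]. }
  rewrite E1, E2, ex_all, (invI M gsM) in HC.
  assert (Ea : all y = neg u ⊔ all x).
  { unfold y. rewrite (join_comm M gsM).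
    rewrite <- (quantified_ex (neg u)) at 1 by now apply quantified_neg.
    rewrite (M4 M mgsM), quantified_ex; [reflexivity | now apply quantified_neg]. }
  rewrite Ea in HC.
  assert (Hu : le (u ⊓ inv (all x)) (inv (neg u ⊔ all x))).
  { rewrite (inv_join M gsM), (inv_complemented M gsM (neg u))
      by apply (complemented_neg M gsM).
    rewrite (negneg_complemented M gsM) by exact Cu. apply (le_refl M gsM). }
  unfold le_at. apply (le_split M gsM) with u; [exact Cu | |].
  - apply (le_meet_imp M gsM) with u; [apply (meet_le_l M gsM)|].
    eapply (le_trans M gsM); [apply (meet_le_r M gsM)|].
    eapply (le_trans M gsM); [exact Hu|].
    eapply (le_trans M gsM); [exact HC|].
    apply (join_le M gsM); apply (le_imp M gsM).
    + eapply (le_trans M gsM); [| apply (bot_min M gsM)].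
      apply (le_neg M gsM), (le_refl M gsM).
    + apply (meet_le_l M gsM).
  - eapply (le_trans M gsM); [| apply (bot_min M gsM)].
    eapply (le_trans M gsM).
    2: apply (le_neg M gsM), (le_refl M gsM).
    apply (le_meet M gsM); [apply (meet_le_l M gsM)|].
    eapply (le_trans M gsM); [apply (meet_le_r M gsM) | apply (meet_le_l M gsM)].
Qed.

(** If [u] were below [delta x], monotonicity would give [u = all u <= all x]. A failure of [all x]
    at [u] thus becomes a failure of [x] itself on a smaller state, in general not a quantified
    one. *)
Lemma witness_state u x :
  state M u -> quantified u -> ~ le u (all x) ->
  state M (u ⊓ neg (delta M x)).
Proof.
  intros Su Qu H. apply (state_meet_neg M gsM); [exact Su | apply (complemented_delta M gsM)|].
  intros H'. apply H. rewrite <- Qu. apply all_mono.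
  eapply (le_trans M gsM); [exact H' | apply (delta_le M gsM)].
Qed.

End Quantifiers.

(** * Functional algebras *)

Lemma proj1_sig_inj (T : Type) (P : T -> Prop) (x y : {t : T | P t}) :
  proj1_sig x = proj1_sig y -> x = y.
Proof.
  destruct x as [x Hx], y as [y Hy]. simpl. intros <-. f_equal.
  apply proof_irrelevance.
Qed.

Lemma is_gs_power (A : gs_algebra) (X : Type) : is_gs A -> is_gs (power A X).
Proof.
  intros H. pose proof (gs_godel A H) as G. pose proof (gs_de_morgan A H) as D.
  pose proof (godel_heyting A G) as Y. pose proof (heyting_lattice A Y) as L.
  pose proof (bounded_lattice A L) as L'.
  assert (Hle : forall f g : power A X, le f g <-> forall i, le (f i) (g i)).
  { intros f g. split; intros E.
    - intros i. exact (f_equal (fun h => h i) E).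
    - unfold le. extensionality i. apply E. }
  assert (B : is_bounded_lattice (power A X)).
  { split; [split | |]; intros; unfold le; extensionality i; simpl.
    - apply (joinC A L').
    - apply (meetC A L').
    - apply (joinA A L').
    - apply (meetA A L').
    - apply (joinK A L').
    - apply (meetK A L').
    - apply (bot_le A L).
    - apply (le_top A L). }
  split; [split; [split; [exact B|] |] | split; [exact B | | |] |].
  - intros x y z. rewrite !Hle.
    split; intros E i; apply (residuation A Y), E.
  - intros x y. extensionality i. apply (prelinearity A G).
  - intros x y z. extensionality i. apply (meet_joinDr A D).
  - intros x. extensionality i. apply (invK A D).
  - intros x y. extensionality i. apply (inv_meet A D).
  - intros x. apply Hle. intros i. apply (neg_le_inv A H).
Qed.

Lemma is_gs_subalgebra (A : gs_algebra) (B : A -> Prop) (subB : subuniverse B) :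
  is_gs A -> is_gs (subalgebra subB).
Proof.
  intros H. pose proof (gs_godel A H) as G. pose proof (gs_de_morgan A H) as D.
  pose proof (godel_heyting A G) as Y. pose proof (heyting_lattice A Y) as L.
  pose proof (bounded_lattice A L) as L'.
  assert (Hle : forall f g : subalgebra subB,
    le f g <-> le (proj1_sig f) (proj1_sig g)).
  { intros f g. split; intros E.
    - exact (f_equal (@proj1_sig _ _) E).
    - now apply proj1_sig_inj. }
  assert (BL : is_bounded_lattice (subalgebra subB)).
  { split; [split | |]; intros; unfold le; apply proj1_sig_inj; simpl.
    - apply (joinC A L').
    - apply (meetC A L').
    - apply (joinA A L').
    - apply (meetA A L').
    - apply (joinK A L').
    - apply (meetK A L').
    - apply (bot_le A L).
    - apply (le_top A L). }
  split; [split; [split; [exact BL|] |] | split; [exact BL | | |] |].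
  - intros x y z. rewrite !Hle. apply (residuation A Y).
  - intros x y. apply proj1_sig_inj, (prelinearity A G).
  - intros x y z. apply proj1_sig_inj, (meet_joinDr A D).
  - intros x. apply proj1_sig_inj, (invK A D).
  - intros x y. apply proj1_sig_inj, (inv_meet A D).
  - intros x. apply Hle, (neg_le_inv A H).
Qed.

Section InfLaws.
Variables (A : gs_algebra) (X : Type).
Hypothesis gsA : is_gs A.
Implicit Types (f : X -> A) (a c : A).

Lemma is_inf_imp_r f a c :
  is_sup f a -> is_inf (fun i => f i ⇒ c) (a ⇒ c).
Proof.
  intros [H1 H2].
  assert (comm : forall x y z : A, le (x ⊓ y) z -> le (y ⊓ x) z).
  { intros x y z H. eapply (le_trans A gsA); [| exact H].
    apply (le_meet A gsA); [apply (meet_le_r A gsA) | apply (meet_le_l A gsA)]. }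
  split.
  - intros i. apply (le_imp A gsA), comm, (le_imp A gsA).
    eapply (le_trans A gsA); [apply H1|].
    apply (le_imp A gsA), comm, (le_imp A gsA), (le_refl A gsA).
  - intros b Hb. apply (le_imp A gsA), comm, (le_imp A gsA), H2.
    intros i. apply (le_imp A gsA), comm, (le_imp A gsA), Hb.
Qed.

Lemma is_inf_imp_l f a c : is_inf f a -> is_inf (fun i => c ⇒ f i) (c ⇒ a).
Proof.
  intros [H1 H2]. split.
  - intros i. apply (le_imp A gsA). eapply (le_trans A gsA); [| apply (H1 i)].
    apply (le_imp A gsA), (le_refl A gsA).
  - intros b Hb. apply (le_imp A gsA), H2. intros i. apply (le_imp A gsA), Hb.
Qed.

(** Residuation does not provide this distributive law; the total order does. A lower bound strictly
    above [c] must lie below each [f i], since otherwise [c ⊔ f i] would be [c]. *)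
Lemma is_inf_join f a c :
  totally_ordered A -> is_inf f a -> is_inf (fun i => c ⊔ f i) (c ⊔ a).
Proof.
  intros tot [H1 H2]. split.
  - intros i. apply (join_le A gsA); [apply (le_join_l A gsA)|].
    eapply (le_trans A gsA); [apply H1 | apply (le_join_r A gsA)].
  - intros b Hb. destruct (tot b c) as [Hc|Hc].
    + eapply (le_trans A gsA); [exact Hc | apply (le_join_l A gsA)].
    + destruct (classic (b = c)) as [->|Hn]; [apply (le_join_l A gsA)|].
      eapply (le_trans A gsA); [| apply (le_join_r A gsA)]. apply H2. intros i.
      destruct (tot (f i) c) as [Hf|Hf].
      * destruct Hn. apply (le_antisym A gsA); [| exact Hc].
        eapply (le_trans A gsA); [apply (Hb i)|].
        apply (join_le A gsA); [apply (le_refl A gsA) | exact Hf].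
      * eapply (le_trans A gsA); [apply (Hb i)|].
        apply (join_le A gsA); [exact Hf | apply (le_refl A gsA)].
Qed.

End InfLaws.

(** With [x] and [y] the values of one function at two points, this becomes axiom (C) for functional
    algebras. *)
Lemma kleene (A : gs_algebra) (x y : A) :
  is_gs A -> totally_ordered A -> le (x ⊓ inv x) (y ⊔ inv y).
Proof.
  intros gsA tot. destruct (tot x y) as [H|H].
  - eapply (le_trans A gsA); [apply (meet_le_l A gsA)|].
    eapply (le_trans A gsA); [exact H | apply (le_join_l A gsA)].
  - eapply (le_trans A gsA); [apply (meet_le_r A gsA)|].
    eapply (le_trans A gsA); [apply (inv_anti A gsA), H | apply (le_join_r A gsA)].
Qed.

Lemma functional_cmgs (M : mgs_algebra) : is_functional M -> is_cmgs M.
Proof.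
  intros [A X B subB exB allB gsA tot [i0] Hex Hall].
  pose proof (is_gs_power A X gsA) as gsP.
  pose proof (is_gs_subalgebra _ B subB gsP) as gsS.
  set (val := fun (f : subalgebra subB) => proj1_sig f : X -> A).
  assert (ext : forall f g, (forall i, val f i = val g i) -> f = g).
  { intros f g H. apply proj1_sig_inj. extensionality i. apply H. }
  assert (all_ex_inf : forall f, exists a, is_inf (val f) a /\
    forall i, val (allB f) i = a).
  { intros f. destruct (Hall f) as (a & Ha & E). exists a. split; [exact Ha|].
    intros i. exact (f_equal (fun h => h i) E). }
  assert (ex_ex_sup : forall f, exists a, is_sup (val f) a /\
    forall i, val (exB f) i = a).
  { intros f. destruct (Hex f) as (a & Ha & E). exists a. split; [exact Ha|].
    intros i. exact (f_equal (fun h => h i) E). }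
  assert (allE : forall f g a, (forall i, g i = val f i) -> is_inf g a ->
    forall i, val (allB f) i = a).
  { intros f g a Hg Ha i. destruct (all_ex_inf f) as (a' & Ha' & ->).
    replace g with (val f) in Ha by (extensionality j; auto).
    exact (is_inf_unique A gsA X _ _ _ Ha' Ha). }
  assert (exE : forall f g a, (forall i, g i = val f i) -> is_sup g a ->
    forall i, val (exB f) i = a).
  { intros f g a Hg Ha i. destruct (ex_ex_sup f) as (a' & Ha' & ->).
    replace g with (val f) in Ha by (extensionality j; auto).
    exact (is_sup_unique A gsA X _ _ _ Ha' Ha). }
  split; [split|]; [exact gsS | | | | | |].
  - intros x. apply ext. intros i. destruct (all_ex_inf x) as (a & Ha & Ea).
    change (val (allB x) i ⇒ val x i = top). rewrite Ea.
    apply (imp_eq_top A gsA), Ha.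
  - intros x y. apply ext. intros i.
    destruct (all_ex_inf y) as (c & Hc & Ec), (ex_ex_sup x) as (a & Ha & Ea).
    change (val (allB (x ⇒ allB y)) i = (val (exB x) i ⇒ val (allB y) i)).
    rewrite Ec, Ea. revert i.
    apply allE with (fun i => val x i ⇒ c); [| now apply is_inf_imp_r].
    intros i. rewrite <- (Ec i). reflexivity.
  - intros x y. apply ext. intros i.
    destruct (all_ex_inf y) as (a & Ha & Ea), (all_ex_inf x) as (c & Hc & Ec).
    change (val (allB (allB x ⇒ y)) i = (val (allB x) i ⇒ val (allB y) i)).
    rewrite Ec, Ea. revert i.
    apply allE with (fun i => c ⇒ val y i); [| now apply is_inf_imp_l].
    intros i. rewrite <- (Ec i). reflexivity.
  - intros x y. apply ext. intros i.
    destruct (all_ex_inf y) as (a & Ha & Ea), (ex_ex_sup x) as (c & Hc & Ec).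
    change (val (allB (exB x ⊔ y)) i = val (exB x) i ⊔ val (allB y) i).
    rewrite Ec, Ea. revert i.
    apply allE with (fun i => c ⊔ val y i); [| now apply is_inf_join].
    intros i. rewrite <- (Ec i). reflexivity.
  - intros x. apply ext. intros i. destruct (all_ex_inf x) as (a & Ha & Ea).
    change (val (allB x) i = inv (val (exB (inv x)) i)).
    rewrite Ea, (exE _ (fun i => inv (val x i)) (inv a)); auto.
    + now rewrite (invI A gsA).
    + now apply is_sup_inv.
  - intros x. apply ext. intros i.
    destruct (ex_ex_sup (x ⊓ inv x)) as (c & Hc & Ec).
    destruct (all_ex_inf (x ⊔ inv x)) as (a & Ha & Ea).
    change (le (val (exB (x ⊓ inv x)) i) (val (allB (x ⊔ inv x)) i)).
    rewrite Ec, Ea. apply Hc. intros j. apply Ha. intros k. now apply kleene.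
Qed.

(** * The Gödel chain of a bounded total order with an antitone involution *)

Section Chain.
Variables (T : Type) (leT : T -> T -> Prop) (invT : T -> T) (botT topT : T).
Hypothesis leT_antisym : forall x y, leT x y -> leT y x -> x = y.
Hypothesis leT_trans : forall x y z, leT x y -> leT y z -> leT x z.
Hypothesis leT_total : forall x y, leT x y \/ leT y x.
Hypothesis botT_min : forall x, leT botT x.
Hypothesis topT_max : forall x, leT x topT.
Hypothesis invT_invol : forall x, invT (invT x) = x.
Hypothesis invT_anti : forall x y, leT x y -> leT (invT y) (invT x).

Definition chain : gs_algebra := {|
  carrier := T;
  join := fun x y => if excluded_middle_informative (leT x y) then y else x;
  meet := fun x y => if excluded_middle_informative (leT x y) then x else y;
  imp := fun x y => if excluded_middle_informative (leT x y) then topT else y;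
  inv := invT;
  bot := botT;
  top := topT
|}.

Lemma leT_refl x : leT x x.
Proof. destruct (leT_total x x); assumption. Qed.

Lemma le_chain (x y : chain) : le x y <-> leT x y.
Proof.
  unfold le. simpl. destruct excluded_middle_informative as [H|H]; [tauto|].
  split; [intros ->; apply leT_refl | intros H'; now destruct H].
Qed.

Lemma chain_total : totally_ordered chain.
Proof. intros x y. rewrite !le_chain. apply leT_total. Qed.

Ltac flip := repeat match goal with
  | leT_total : (forall x y, ?leT x y \/ ?leT y x), H : ~ ?leT ?x ?y |- _ =>
      destruct (leT_total x y) as [?|?]; [now destruct H | revert H]
  end; intros.

Lemma chain_gs : is_gs chain.
Proof.
  assert (L : is_bounded_lattice chain).
  { split; [split | |]; intros; try apply le_chain; auto; simpl;
      repeat destruct excluded_middle_informative; auto;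
      try (apply leT_antisym); try tauto;
      repeat match goal with
      | H : ~ leT ?x ?y |- _ =>
          destruct (leT_total x y) as [?H|?H]; [now destruct H | clear H]
      end; eauto using leT_refl. }
  split; [split; [split; [exact L|]|] | split; [exact L| | |]|].
  - intros x y z. rewrite !le_chain. simpl.
    repeat destruct excluded_middle_informative; split; intros; auto;
      flip; eauto; exfalso; eauto.
  - intros x y. simpl. repeat destruct excluded_middle_informative; auto;
      try (apply leT_antisym; now auto); flip; try tauto;
      apply leT_antisym; auto; exfalso; auto.
  - intros x y z. simpl. repeat destruct excluded_middle_informative; auto;
      try (apply leT_antisym); try tauto; flip; eauto using leT_refl; exfalso; eauto.
  - exact invT_invol.
  - intros x y. simpl. repeat destruct excluded_middle_informative; auto;
     apply leT_antisym; auto; flip; eauto.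
  - intros x. apply le_chain. simpl.
    destruct excluded_middle_informative as [H|H]; [| apply botT_min].
    rewrite (leT_antisym x botT) by auto.
    rewrite <- (invT_invol topT). apply invT_anti, botT_min.
Qed.

End Chain.

(** * Positions in a finite preorder with an antitone involution *)

Open Scope Z_scope.

Definition sumZ (l : list Z) : Z := fold_right Z.add 0 l.

Lemma sumZ_le (T : Type) (f g : T -> Z) (l : list T) :
  (forall x, In x l -> f x <= g x) -> sumZ (map f l) <= sumZ (map g l).
Proof.
  induction l as [|a l IH]; intros H; simpl; [lia|].
  pose proof (H a (or_introl eq_refl)).
  assert (sumZ (map f l) <= sumZ (map g l)) by (apply IH; intros; apply H; now right).
  lia.
Qed.

Lemma sumZ_lt (T : Type) (f g : T -> Z) (l : list T) a :
  (forall x, In x l -> f x <= g x) -> In a l -> f a < g a ->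
  sumZ (map f l) < sumZ (map g l).
Proof.
  induction l as [|b l IH]; intros H Ha Hlt; [destruct Ha|]. simpl.
  assert (H' : forall x, In x l -> f x <= g x) by (intros; apply H; now right).
  destruct Ha as [->|Ha].
  - pose proof (sumZ_le T f g l H'). lia.
  - pose proof (H b (or_introl eq_refl)). specialize (IH H' Ha Hlt). lia.
Qed.

Lemma sumZ_add (T : Type) (f g : T -> Z) (l : list T) :
  sumZ (map (fun x => f x + g x) l) = sumZ (map f l) + sumZ (map g l).
Proof. induction l as [|a l IH]; simpl; lia. Qed.

Lemma sumZ_opp (T : Type) (f : T -> Z) (l : list T) :
  sumZ (map (fun x => - f x) l) = - sumZ (map f l).
Proof. induction l as [|a l IH]; simpl; lia. Qed.

Lemma sumZ_permutation (l l' : list Z) : Permutation l l' -> sumZ l = sumZ l'.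
Proof. induction 1; simpl; lia. Qed.

Definition indicator (P : Prop) : Z := if excluded_middle_informative P then 1 else 0.

Lemma indicator_cases (P : Prop) : (P /\ indicator P = 1) \/ (~ P /\ indicator P = 0).
Proof. unfold indicator. destruct excluded_middle_informative; auto. Qed.

Section Position.
Variables (T : Type) (s : T -> T) (d : T) (W : T -> Prop) (R : T -> T -> Prop).
Hypothesis s_invol : forall x, s (s x) = x.
Hypothesis s_fixed : s d = d.
Hypothesis W_fixed : W d.
Hypothesis W_s : forall x, W x -> W (s x).
Hypothesis R_trans : forall x y z, W x -> W y -> W z -> R x y -> R y z -> R x z.
Hypothesis R_total : forall x y, W x -> W y -> R x y \/ R y x.
Hypothesis R_anti : forall x y, W x -> W y -> R x y -> R (s y) (s x).

Definition equiv x y : Prop := R x y /\ R y x.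

Definition cmp x y : Z := indicator (R y x) - indicator (R x y).

(** Counting entries below [x] positively and those above negatively makes the involution act as
    negation. For [2m + 1] inequivalent levels, the levels receive the even numbers from [-2m] to
    [2m] and the gaps the odd numbers between them. *)
Definition position (L : list T) x : Z := sumZ (map (cmp x) L).

Definition multiplicity (L : list T) x : Z :=
  sumZ (map (fun l => indicator (equiv x l)) L).

Definition distinct (L : list T) : Prop :=
  ForallOrdPairs (fun x y => ~ equiv x y) L.

Definition symmetric (L : list T) : Prop := Permutation (map s L) L.

Ltac cases P := let H := fresh in let E := fresh in
  destruct (indicator_cases P) as [[H E]|[H E]]; rewrite ?E.

Lemma cmp_mono x y l : W x -> W y -> W l -> R x y -> cmp x l <= cmp y l.
Proof.
  intros Hx Hy Hl H. unfold cmp.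
  cases (R l x); cases (R x l); cases (R l y); cases (R y l); try lia; exfalso.
  all: try (destruct (R_total x l); tauto); try (destruct (R_total y l); tauto); eauto.
Qed.

Lemma cmp_inv x y : W x -> W y -> cmp (s x) y = - cmp x (s y).
Proof.
  intros Hx Hy.
  assert (H1 : R y (s x) <-> R x (s y)).
  { split; intros H; apply R_anti in H; auto; now rewrite s_invol in H. }
  assert (H2 : R (s x) y <-> R (s y) x).
  { split; intros H; apply R_anti in H; auto; now rewrite s_invol in H. }
  unfold cmp.
  cases (R y (s x)); cases (R (s x) y); cases (R (s y) x); cases (R x (s y));
    try lia; tauto.
Qed.

Section List.
Variable L : list T.
Hypothesis L_W : forall l, In l L -> W l.

Lemma position_mono x y : W x -> W y -> R x y -> position L x <= position L y.
Proof. intros Hx Hy H. apply sumZ_le. intros l Hl. apply cmp_mono; auto. Qed.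

(** The entry [l] makes the difference: it counts at most 0 for [x] and at least 0 for [y], and 0
    for both would give [R y x]. *)
Lemma position_strict x y l :
  W x -> W y -> In l L -> R x l -> R l y -> ~ R y x ->
  position L x < position L y.
Proof.
  intros Hx Hy Hl H1 H2 Hn.
  assert (Wl : W l) by auto.
  apply sumZ_lt with l; auto.
  - intros k Hk. apply cmp_mono; eauto.
  - unfold cmp. cases (R l x); cases (R x l); cases (R l y); cases (R y l);
      try lia; try tauto. destruct Hn. eauto.
Qed.

Lemma position_inv x : symmetric L -> W x -> position L (s x) = - position L x.
Proof.
  intros HL Hx. unfold position at 2. rewrite <- (sumZ_permutation _ _ (Permutation_map _ HL)).
  rewrite map_map, <- sumZ_opp. unfold position. f_equal.
  apply map_ext_in. intros l Hl. apply cmp_inv; auto.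
Qed.

(** Here [n] is the number of entries strictly above [x]. The point of the formula is that length
    and multiplicity fix the parity of the position. *)
Lemma position_count x : W x -> exists n, 0 <= n /\
  position L x = Z.of_nat (length L) - multiplicity L x - 2 * n.
Proof.
  intros Hx. unfold position, multiplicity. induction L as [|l L' IH].
  - exists 0. simpl. lia.
  - destruct IH as (n & Hn & E); [intros; apply L_W; now right|].
    assert (Hl : W l) by (apply L_W; now left).
    pose proof (R_total x l Hx Hl) as tot.
    exists (n + indicator (~ R l x)).
    cbn [map sumZ fold_right length]. unfold cmp at 1. unfold equiv at 1.
    fold (sumZ (map (cmp x) L')).
    fold (sumZ (map (fun l => indicator (equiv x l)) L')).
    cases (R l x); cases (R x l); cases (~ R l x); cases (R x l /\ R l x);
      try tauto; lia.
Qed.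

Lemma position_max x :
  (forall l, In l L -> R l x) ->
  position L x = Z.of_nat (length L) - multiplicity L x.
Proof.
  unfold position, multiplicity. clear L_W. induction L as [|l L' IH]; intros H.
  - reflexivity.
  - cbn [map sumZ fold_right length]. fold (sumZ (map (cmp x) L')).
    fold (sumZ (map (fun l => indicator (equiv x l)) L')).
    rewrite IH by (intros; apply H; now right).
    assert (R l x) by (apply H; now left). unfold cmp.
    cases (R l x); cases (R x l); cases (equiv x l); try lia; unfold equiv in *; tauto.
Qed.

Lemma position_abs x : Z.abs (position L x) <= Z.of_nat (length L).
Proof.
  unfold position. clear L_W. induction L as [|l L' IH]; [simpl; lia|].
  cbn [map sumZ fold_right length]. fold (sumZ (map (cmp x) L')).
  unfold cmp at 1. cases (R l x); cases (R x l); lia.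
Qed.

Lemma multiplicity_distinct x :
  distinct L -> W x ->
  ((exists l, In l L /\ equiv x l) -> multiplicity L x = 1) /\
  (~ (exists l, In l L /\ equiv x l) -> multiplicity L x = 0).
Proof.
  intros HL Hx. unfold multiplicity.
  induction HL as [|l L' Hl HL IH].
  - split; [intros (l & [] & _) | reflexivity].
  - destruct IH as [IH1 IH0]; [intros; apply L_W; now right|].
    assert (Wl : W l) by (apply L_W; now left).
    cbn [map sumZ fold_right]. fold (sumZ (map (fun l => indicator (equiv x l)) L')).
    split.
    + intros (k & Hk & Ek).
      cases (equiv x l).
      * rewrite IH0; [lia|]. intros (k' & Hk' & Ek').
        rewrite Forall_forall in Hl. apply (Hl k' Hk').
        assert (W k') by (apply L_W; now right).
        destruct H, Ek'. split; eauto.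
      * destruct Hk as [->|Hk]; [tauto|]. rewrite IH1; [lia | eauto].
    + intros Hn. cases (equiv x l); [destruct Hn; exists l; simpl; tauto|].
      rewrite IH0; [lia|]. intros (k & Hk & Ek). apply Hn. exists k. simpl. tauto.
Qed.

(** If [y] has the same levels below it as [x], then [x] is at the level [y]
    or in the gap just above. *)
Lemma position_floor x y :
  W x -> W y -> (forall l, In l L -> R l x -> R l y) ->
  position L x <= position L y + multiplicity L y.
Proof.
  intros Hx Hy H. unfold position, multiplicity. rewrite <- sumZ_add.
  apply sumZ_le. intros l Hl. specialize (H l Hl). unfold cmp, equiv.
  pose proof (R_total y l Hy (L_W l Hl)).
  pose proof (R_total x l Hx (L_W l Hl)).
  cases (R l x); cases (R x l); cases (R l y); cases (R y l);
    cases (R y l /\ R l y); try lia; tauto.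
Qed.

End List.

(** Entries enter in pairs [w], [s w], so that [s] permutes the list itself and not only its
    equivalence classes; hence an entry may be the image of a member of [L0]. The initial [d] keeps
    the length odd. *)
Lemma exists_levels (L0 : list T) :
  (forall x, In x L0 -> W x) ->
  exists (L : list T) (m : nat),
    (forall l, In l L -> l = d \/ In l L0 \/ In (s l) L0) /\
    distinct L /\ symmetric L /\
    (forall x, x = d \/ In x L0 -> exists l, In l L /\ equiv x l) /\
    length L = (2 * m + 1)%nat.
Proof.
  assert (R_refl : forall x, W x -> R x x) by (intros x Hx; destruct (R_total x x); auto).
  induction L0 as [|w L0 IH]; intros H0.
  - exists [d], 0%nat. repeat split.
    + simpl. intuition.
    + repeat constructor.
    + unfold symmetric. simpl. now rewrite s_fixed.
    + intros x [->|[]]. exists d. split; [now left | split; auto].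
  - destruct IH as (L & m & HL & Hd & Hs & Hc & Hm); [intros; apply H0; now right|].
    assert (Ww : W w) by (apply H0; now left).
    assert (WL : forall l, In l L -> W l).
    { intros l Hl. destruct (HL l Hl) as [->|[Hl'|Hl']]; auto.
      - apply H0. now right.
      - rewrite <- s_invol. apply W_s, H0. now right. }
    destruct (classic (exists l, In l L /\ equiv w l)) as [Hw|Hw].
    + exists L, m. repeat split; auto.
      * intros l Hl. destruct (HL l Hl) as [|[|]]; simpl; auto.
      * intros x [->|[<-|Hx]]; auto.
    + exists (w :: s w :: L), (S m).
      assert (Hw' : forall l, In l L -> ~ equiv (s w) l).
      { intros l Hl [E1 E2]. apply Hw. exists (s l). split.
        - apply (Permutation_in _ Hs). now apply in_map.
        - split; rewrite <- (s_invol w); apply R_anti; auto. }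
      (* Were [w] and [s w] equivalent, comparing [w] with the fixed [d] and applying [s] would make
         [w] equivalent to [d], which already has a representative. *)
      assert (Hww : ~ equiv w (s w)).
      { intros [E1 E2]. destruct (Hc d (or_introl eq_refl)) as (l & Hl & E3 & E4).
        apply Hw. exists l. split; [exact Hl|].
        assert (Wl : W l) by auto.
        assert (Wsw : W (s w)) by auto.
        destruct (R_total w d Ww W_fixed) as [E|E];
          pose proof E as E'; apply R_anti in E'; auto; rewrite s_fixed in E'.
        - assert (R d w) by (apply R_trans with (s w); auto). split; eauto.
        - assert (R w d) by (apply R_trans with (s w); auto). split; eauto. }
      repeat split.
      * intros l [<-|[<-|Hl]]; simpl; auto.
        destruct (HL l Hl) as [|[|]]; auto.
      * constructor; [constructor; [exact Hww|] | constructor; [| exact Hd]].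
        -- apply Forall_forall. intros l Hl E. apply Hw. now exists l.
        -- now apply Forall_forall.
      * unfold symmetric. simpl. rewrite s_invol.
        eapply perm_trans; [apply perm_swap|].
        now do 2 apply perm_skip.
      * intros x Hx. destruct (classic (x = w)) as [->|Hn].
        -- exists w. split; [now left | split; auto].
        -- destruct (Hc x) as (l & Hl & E); [destruct Hx as [|[|]]; subst; tauto|].
           exists l. split; [now do 2 right | exact E].
      * simpl. lia.
Qed.

End Position.

Lemma position_ext (T : Type) (R R' : T -> T -> Prop) (L : list T) (x : T) :
  (forall l, In l L -> (R x l <-> R' x l) /\ (R l x <-> R' l x)) ->
  position T R L x = position T R' L x.
Proof.
  intros H. unfold position. f_equal. apply map_ext_in. intros l Hl.
  destruct (H l Hl) as [H1 H2]. unfold cmp.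
  destruct (indicator_cases (R x l)) as [[? ->]|[? ->]],
    (indicator_cases (R' x l)) as [[? ->]|[? ->]],
    (indicator_cases (R l x)) as [[? ->]|[? ->]],
    (indicator_cases (R' l x)) as [[? ->]|[? ->]]; tauto.
Qed.

(** * Finite sets *)

Lemma finite_sig (T : Type) (P : T -> Prop) (l : list T) :
  exists l' : list {x | P x}, forall x, In (proj1_sig x) l -> In x l'.
Proof.
  induction l as [|a l [l' IH]].
  - exists []. intros x [].
  - destruct (classic (P a)) as [Ha|Ha].
    + exists (exist P a Ha :: l'). intros x [E|Hx]; [left | right; auto].
      apply proj1_sig_inj. exact E.
    + exists l'. intros x [E|Hx]; auto. destruct Ha. rewrite E. apply proj2_sig.
Qed.

Lemma finite_functions (I T : Type) (li : list I) (lt : list T) (t : T) :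
  exists lf : list (I -> T), forall f, (forall i, In (f i) lt) ->
    exists g, In g lf /\ forall i, In i li -> f i = g i.
Proof.
  induction li as [|i li [lf IH]].
  - exists [fun _ => t]. intros f _. exists (fun _ => t). simpl. intuition.
  - exists (flat_map (fun g => map (fun a j =>
      if excluded_middle_informative (j = i) then a else g j) lt) lf).
    intros f Hf. destruct (IH f Hf) as (g & Hg & E).
    exists (fun j => if excluded_middle_informative (j = i) then f i else g j).
    split.
    + apply in_flat_map. exists g. split; [exact Hg|].
      apply in_map_iff. exists (f i). split; [reflexivity | apply Hf].
    + intros j Hj. destruct excluded_middle_informative as [->|Hn]; [reflexivity|].
      destruct Hj as [->|Hj]; [tauto | auto].
Qed.

Lemma exists_min (I : Type) (g : I -> Z) :
  Finite I -> inhabited I -> exists i, forall j, g i <= g j.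
Proof.
  intros [l Hl] [i0].
  assert (H : exists i, forall j, In j l -> g i <= g j).
  { clear Hl. induction l as [|a l [i IH]]; [exists i0; intros j [] |].
    destruct (Z.le_ge_cases (g a) (g i)).
    - exists a. intros j [->|Hj]; [lia|]. specialize (IH j Hj). lia.
    - exists i. intros j [<-|Hj]; auto. }
  destruct H as [i Hi]. exists i. auto.
Qed.

Lemma in_Z_range (n a : Z) :
  Z.abs a <= n -> In a (map (fun k => Z.of_nat k - n) (seq 0 (Z.to_nat (2 * n + 1)))).
Proof.
  intros H. apply in_map_iff. exists (Z.to_nat (a + n)). split; [lia|].
  apply in_seq. lia.
Qed.

(** * A chain with levels and gaps *)

#[local] Arguments Z.mul : simpl never.
#[local] Arguments Z.modulo : simpl never.
#[local] Arguments Z.opp : simpl never.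

(** Even first coordinates are levels, odd ones are gaps filled by a copy of
    [Z]; [(0, 0)] is the fixed point. *)
Definition is_point (m : nat) (p : Z * Z) : Prop :=
  Z.abs (fst p) <= 2 * Z.of_nat m /\ (fst p mod 2 = 0 -> snd p = 0).

Definition lex (p q : Z * Z) : Prop :=
  fst p < fst q \/ (fst p = fst q /\ snd p <= snd q).

Definition opp (p : Z * Z) : Z * Z := (- fst p, - snd p).

(** The factor [Z.sgn] directs the movement away from the centre, so that it commutes with [opp]. In
    a gap the first coordinate is odd, hence nonzero, so every height of the gap is reached as [j]
    varies. *)
Definition shift (j : Z) (p : Z * Z) : Z * Z :=
  (fst p, if fst p mod 2 =? 0 then snd p else snd p + j * Z.sgn (fst p)).

Ltac parity := unfold is_point, lex, opp, shift in *; cbn [fst snd] in *;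
  repeat match goal with
  | |- context [?a mod 2 =? 0] => destruct (Z.eqb_spec (a mod 2) 0)
  | H : context [?a mod 2 =? 0] |- _ => destruct (Z.eqb_spec (a mod 2) 0)
  end; Z.to_euclidean_division_equations; try nia.

Section LevelChain.
Variable m : nat.

Definition point : Type := {p : Z * Z | is_point m p}.

Definition rank (a : point) : Z := fst (proj1_sig a).

Lemma is_point_opp p : is_point m p -> is_point m (opp p).
Proof. intros H. parity. Qed.

Lemma is_point_shift j p : is_point m p -> is_point m (shift j p).
Proof. intros H. parity. Qed.

Lemma is_point_level q :
  Z.abs q <= 2 * Z.of_nat m -> is_point m (q, 0).
Proof. intros H. parity. Qed.

Definition opp_point (a : point) : point :=
  exist _ _ (is_point_opp _ (proj2_sig a)).

Definition shift_point (j : Z) (a : point) : point :=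
  exist _ _ (is_point_shift j _ (proj2_sig a)).

Definition level (q : Z) (H : Z.abs q <= 2 * Z.of_nat m) : point :=
  exist _ _ (is_point_level q H).

Lemma top_bound : Z.abs (2 * Z.of_nat m) <= 2 * Z.of_nat m.
Proof. lia. Qed.

Lemma bot_bound : Z.abs (- (2 * Z.of_nat m)) <= 2 * Z.of_nat m.
Proof. lia. Qed.

Definition lex_point (a b : point) : Prop := lex (proj1_sig a) (proj1_sig b).

Definition levels : gs_algebra :=
  chain point lex_point opp_point (level _ bot_bound) (level _ top_bound).

Lemma point_eq (a b : point) :
  fst (proj1_sig a) = fst (proj1_sig b) ->
  snd (proj1_sig a) = snd (proj1_sig b) -> a = b.
Proof.
  intros H1 H2. apply proj1_sig_inj.
  destruct (proj1_sig a), (proj1_sig b). simpl in *. now subst.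
Qed.

Lemma lex_point_antisym a b : lex_point a b -> lex_point b a -> a = b.
Proof.
  unfold lex_point, lex. intros H1 H2. apply point_eq; lia.
Qed.

Lemma lex_point_total a b : lex_point a b \/ lex_point b a.
Proof. unfold lex_point, lex. lia. Qed.

Lemma levels_gs : is_gs levels.
Proof.
  apply chain_gs.
  - apply lex_point_antisym.
  - intros a b c. unfold lex_point, lex. lia.
  - apply lex_point_total.
  - intros [[q z] H]. unfold lex_point. simpl. parity.
  - intros [[q z] H]. unfold lex_point. simpl. parity.
  - intros a. apply point_eq; simpl; lia.
  - intros a b. unfold lex_point, lex. simpl. lia.
Qed.

Lemma levels_total : totally_ordered levels.
Proof. apply chain_total, lex_point_total. Qed.

Lemma le_levels (a b : levels) : le a b <-> lex_point a b.
Proof. apply le_chain, lex_point_total. Qed.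

(** Each gap is translated as a whole. Join, meet and implication on a chain only select among their
    arguments and top, so preserving and reflecting the order is enough to commute with them. *)
Lemma lex_shift j a b :
  lex_point (shift_point j a) (shift_point j b) <-> lex_point a b.
Proof.
  destruct a as [[q z] H], b as [[q' z'] H']. unfold lex_point. simpl.
  unfold lex, shift. simpl. split; intros [E|[-> E]]; auto; right; (split; [reflexivity|]);
    destruct (q' mod 2 =? 0); lia.
Qed.

Lemma shift_fixes_level j (a : point) : rank a mod 2 = 0 -> shift_point j a = a.
Proof.
  intros H. apply point_eq; [reflexivity|]. simpl. unfold rank in H.
  now rewrite H.
Qed.

Lemma shift_join j (a b : levels) :
  shift_point j (a ⊔ b) = ((shift_point j a : levels) ⊔ (shift_point j b : levels)).
Proof.
  simpl. pose proof (lex_shift j a b).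
  repeat destruct excluded_middle_informative; tauto.
Qed.

Lemma shift_meet j (a b : levels) :
  shift_point j (a ⊓ b) = ((shift_point j a : levels) ⊓ (shift_point j b : levels)).
Proof.
  simpl. pose proof (lex_shift j a b).
  repeat destruct excluded_middle_informative; tauto.
Qed.

Lemma rank_level q H : rank (level q H) = q.
Proof. reflexivity. Qed.

Lemma even_top : rank (top : levels) mod 2 = 0.
Proof. simpl. rewrite rank_level. parity. Qed.

Lemma even_bot : rank (bot : levels) mod 2 = 0.
Proof. simpl. rewrite rank_level. parity. Qed.

Lemma shift_imp j (a b : levels) :
  shift_point j (a ⇒ b) = ((shift_point j a : levels) ⇒ (shift_point j b : levels)).
Proof.
  pose proof (shift_fixes_level j _ even_top) as E.
  simpl. pose proof (lex_shift j a b).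
  repeat destruct excluded_middle_informative; tauto.
Qed.

Lemma shift_inv j (a : levels) : shift_point j (inv a) = inv (shift_point j a : levels).
Proof.
  destruct a as [[q z] H]. apply point_eq; [reflexivity|]. simpl.
  unfold shift, opp. simpl.
  replace ((- q) mod 2 =? 0) with (q mod 2 =? 0).
  - destruct (q mod 2 =? 0); [reflexivity | lia].
  - destruct (Z.eqb_spec (q mod 2) 0), (Z.eqb_spec ((- q) mod 2) 0); auto; parity.
Qed.

(** * The finite algebra of functions that follow the shifts *)

Section Family.
Variables (I : Type) (N : Z).
Hypothesis finI : Finite I.
Hypothesis inhI : inhabited I.
Hypothesis N_ge0 : 0 <= N.

Definition bounded (a : point) : Prop := Z.abs (snd (proj1_sig a)) <= N.

(** The integer index acts only through the shift, so the values at [(i, 0)] determine a member;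
    bounding them leaves finitely many members. *)
Definition family (f : power levels (I * Z)) : Prop :=
  forall i, bounded (f (i, 0)) /\ forall j, f (i, j) = shift_point j (f (i, 0)).

Lemma bounded_level (a : point) : rank a mod 2 = 0 -> bounded a.
Proof.
  intros H. unfold bounded. destruct (proj2_sig a) as [_ H0]. rewrite H0 by exact H. lia.
Qed.

Lemma family_level (a : point) : rank a mod 2 = 0 -> family (fun _ => a).
Proof.
  intros H i. split; [now apply bounded_level|]. intros j. now rewrite shift_fixes_level.
Qed.

Lemma family_subuniverse : subuniverse family.
Proof.
  split.
  - intros f g Hf Hg i. destruct (Hf i) as [bf Ef], (Hg i) as [bg Eg]. split.
    + simpl. destruct excluded_middle_informative; assumption.
    + intros j. change (f (i, j) ⊔ g (i, j) = shift_point j (f (i, 0) ⊔ g (i, 0))).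
      now rewrite Ef, Eg, shift_join.
  - intros f g Hf Hg i. destruct (Hf i) as [bf Ef], (Hg i) as [bg Eg]. split.
    + simpl. destruct excluded_middle_informative; assumption.
    + intros j. change (f (i, j) ⊓ g (i, j) = shift_point j (f (i, 0) ⊓ g (i, 0))).
      now rewrite Ef, Eg, shift_meet.
  - intros f g Hf Hg i. destruct (Hf i) as [bf Ef], (Hg i) as [bg Eg]. split.
    + simpl. destruct excluded_middle_informative; [| assumption].
      apply bounded_level, even_top.
    + intros j. change ((f (i, j) ⇒ g (i, j)) = shift_point j (f (i, 0) ⇒ g (i, 0))).
      now rewrite Ef, Eg, shift_imp.
  - intros f Hf i. destruct (Hf i) as [bf Ef]. split.
    + unfold bounded in *. simpl. lia.
    + intros j. change (inv (f (i, j)) = shift_point j (inv (f (i, 0)))).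
      now rewrite Ef, shift_inv.
  - exact (family_level _ even_bot).
  - exact (family_level _ even_top).
Qed.

(** Either [c] is attained at [i], or the values at [i] descend without end through the gap just
    above [c], so that no lower bound lies in that gap. *)
Lemma is_inf_family (f : power levels (I * Z)) (c : levels) (i : I) :
  family f -> rank c mod 2 = 0 ->
  (forall i', rank c <= rank (f (i', 0))) -> rank (f (i, 0)) <= rank c + 1 ->
  is_inf (A := levels) f c.
Proof.
  intros Hf Hc Hle Hi. split.
  - intros [i' j]. apply le_levels. rewrite (proj2 (Hf i')).
    specialize (Hle i'). destruct (f (i', 0)) as [[q z] H], c as [[q' z'] H'].
    unfold rank, lex_point in *. simpl in *. parity.
  - intros b Hb. apply le_levels.
    assert (Hb' : forall j, lex_point b (shift_point j (f (i, 0)))).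
    { intros j. rewrite <- (proj2 (Hf i)). apply le_levels, Hb. }
    specialize (Hle i). destruct (f (i, 0)) as [[q z] H], c as [[q' z'] H'].
    destruct b as [[q'' z''] H''].
    (* In a gap, one of these two shifts moves the value at [i] to height [z'' - 1], one below that
       of [b]; the sign of [q] decides which. *)
    pose proof (Hb' (z'' - z - 1)) as B1. pose proof (Hb' (- (z'' - z - 1))) as B2.
    unfold rank, lex_point in *. simpl in *.
    assert (Hs : q = q' + 1 -> q'' <> q).
    { intros -> ->. unfold lex, shift in B1, B2. simpl in B1, B2.
      assert (E : (q' + 1) mod 2 =? 0 = false).
      { clear - Hc. apply Z.eqb_neq. parity. }
      rewrite E in B1, B2.
      assert (q' + 1 <> 0) by (intros E'; rewrite E' in E; discriminate).
      destruct (Z.sgn_spec (q' + 1)) as [[_ E']|[[? E']|[_ E']]];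
        rewrite E' in B1, B2; lia. }
    clear Hb'. unfold lex, shift in B1. simpl in B1.
    unfold is_point in *. simpl in *.
    pose proof (proj2 H'' : q'' mod 2 = 0 -> z'' = 0).
    pose proof (proj2 H' : q' mod 2 = 0 -> z' = 0).
    unfold lex. simpl.
    destruct (Z.eq_dec q'' q') as [->|Hn]; [right; split; [reflexivity | lia]|].
    left. destruct (Z.eq_dec q (q' + 1)) as [->|Hn']; [specialize (Hs eq_refl); lia|].
    assert (q = q') by lia. lia.
Qed.

Lemma exists_inf_family (f : power levels (I * Z)) :
  family f -> exists c : levels, rank c mod 2 = 0 /\ is_inf (A := levels) f c.
Proof.
  intros Hf.
  destruct (exists_min I (fun i => rank (f (i, 0))) finI inhI) as [i Hi].
  pose proof (proj2_sig (f (i, 0))) as [Hb _]. fold (rank (f (i, 0))) in Hb.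
  (* The remainder modulo 2 is never negative, so subtracting it lowers an odd rank to the level
     just below, also for negative ranks. *)
  assert (H : Z.abs (rank (f (i, 0)) - rank (f (i, 0)) mod 2) <= 2 * Z.of_nat m) by parity.
  exists (level _ H). rewrite rank_level. split; [parity|].
  apply (is_inf_family f _ i); auto; rewrite ?rank_level.
  - parity.
  - intros i'. specialize (Hi i'). parity.
  - parity.
Qed.

Definition family_algebra : gs_algebra := subalgebra family_subuniverse.

Definition family_all (f : family_algebra) : family_algebra :=
  let c := constructive_indefinite_description _
    (exists_inf_family (proj1_sig f) (proj2_sig f)) in
  exist family (fun _ => proj1_sig c) (family_level _ (proj1 (proj2_sig c))).

Definition family_model : mgs_algebra :=
  MgsAlgebra family_algebra (fun f => inv (family_all (inv f))) family_all.

Lemma family_all_spec (f : family_algebra) :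
  exists a, is_inf (A := levels) (proj1_sig f) a /\
    proj1_sig (family_all f) = (fun _ => a).
Proof.
  unfold family_all. destruct constructive_indefinite_description as (c & Hc & H).
  exists c. split; [exact H | reflexivity].
Qed.

Lemma family_model_functional : is_functional family_model.
Proof.
  apply Functional.
  - apply levels_gs.
  - apply levels_total.
  - destruct inhI as [i]. exact (inhabits (i, 0)).
  - intros f. destruct (family_all_spec (inv (f : family_algebra))) as (a & Ha & E).
    exists (inv a). split.
    + apply (is_sup_inv levels levels_gs) in Ha.
      replace (proj1_sig f) with (fun i => inv (inv (proj1_sig f i))); [exact Ha|].
      extensionality i. apply (invI levels levels_gs).
    + extensionality i. exact (f_equal (fun h => inv (h i)) E).
  - apply family_all_spec.
Qed.

Lemma family_model_fixed_point : has_fixed_point family_model.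
Proof.
  assert (H : Z.abs 0 <= 2 * Z.of_nat m) by lia.
  exists (exist family (fun _ => level 0 H) (family_level (level 0 H) eq_refl)).
  apply proj1_sig_inj. extensionality i. now apply point_eq.
Qed.

Lemma family_model_finite : Finite family_model.
Proof.
  destruct finI as [li Hli].
  set (range := fun n => map (fun k => Z.of_nat k - n) (seq 0 (Z.to_nat (2 * n + 1)))).
  destruct (finite_sig _ (is_point m) (list_prod (range (2 * Z.of_nat m)) (range N)))
    as [lp Hlp].
  assert (Hlp' : forall a : point, bounded a -> In a lp).
  { intros [[q z] H] Ha. apply Hlp. simpl. apply in_prod; apply in_Z_range.
    - apply H.
    - exact Ha. }
  destruct (finite_functions I point li lp (level _ bot_bound)) as [lf Hlf].
  destruct (finite_sig _ family
    (map (fun g (x : I * Z) => shift_point (snd x) (g (fst x))) lf)) as [l Hl].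
  exists l. intros [f Hf]. apply Hl. simpl.
  destruct (Hlf (fun i => f (i, 0))) as (g & Hg & E).
  - intros i. apply Hlp', Hf.
  - apply in_map_iff. exists g. split; [| exact Hg].
    extensionality x. destruct x as [i j]. simpl. rewrite <- E by apply Hli.
    symmetry. apply Hf.
Qed.

End Family.
End LevelChain.

(** * Coordinates in the chain of levels *)

Section Coordinates.
Variables (T : Type) (s : T -> T) (W : T -> Prop) (R : T -> T -> Prop).
Hypothesis s_invol : forall x, s (s x) = x.
Hypothesis W_s : forall x, W x -> W (s x).
Hypothesis R_trans : forall x y z, W x -> W y -> W z -> R x y -> R y z -> R x z.
Hypothesis R_total : forall x y, W x -> W y -> R x y \/ R y x.
Hypothesis R_anti : forall x y, W x -> W y -> R x y -> R (s y) (s x).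

Variables (Lv S : list T) (m : nat) (t : T).
Hypothesis Lv_W : forall l, In l Lv -> W l.
Hypothesis S_W : forall l, In l S -> W l.
Hypothesis Lv_sym : symmetric T s Lv.
Hypothesis S_sym : symmetric T s S.
Hypothesis Lv_distinct : distinct T R Lv.
Hypothesis Lv_length : length Lv = (2 * m + 1)%nat.
Hypothesis t_W : W t.
Hypothesis t_max : forall x, W x -> R x t.
Hypothesis t_level : exists l, In l Lv /\ equiv T R t l.

Definition coordinates x : Z * Z :=
  let q := position T R Lv x in
  (q, if q mod 2 =? 0 then 0 else position T R S x).

(** The length [2m + 1] is odd, so the position has the parity of 1 plus the multiplicity, which is
    1 on levels and 0 in gaps. *)
Lemma position_even_iff x :
  W x -> (position T R Lv x mod 2 = 0 <-> exists l, In l Lv /\ equiv T R x l).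
Proof.
  intros Hx.
  destruct (position_count T W R R_total Lv Lv_W x Hx) as (n & Hn & E).
  destruct (multiplicity_distinct T W R R_trans Lv Lv_W x Lv_distinct Hx) as [H1 H0].
  rewrite E, Lv_length. split.
  - intros H. apply NNPP. intros Hno. rewrite (H0 Hno) in H. parity.
  - intros H. rewrite (H1 H). parity.
Qed.

Lemma coordinates_top : coordinates t = (2 * Z.of_nat m, 0).
Proof.
  unfold coordinates.
  rewrite (position_max T R Lv t) by auto.
  destruct (multiplicity_distinct T W R R_trans Lv Lv_W t Lv_distinct t_W) as [-> _];
    [| exact t_level].
  rewrite Lv_length.
  replace (Z.of_nat (2 * m + 1) - 1) with (2 * Z.of_nat m) by lia.
  replace (2 * Z.of_nat m mod 2 =? 0) with true; [reflexivity|].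
  symmetry. apply Z.eqb_eq. parity.
Qed.

(** The upper bound is the position of [t]; the lower bound is the upper bound for [s x]. *)
Lemma coordinates_point x : W x -> is_point m (coordinates x).
Proof.
  intros Hx.
  assert (H : forall y, W y -> position T R Lv y <= 2 * Z.of_nat m).
  { intros y Hy. pose proof (f_equal fst coordinates_top) as E. simpl in E.
    rewrite <- E. apply (position_mono T W R R_trans R_total); auto. }
  split; simpl.
  - pose proof (H x Hx). pose proof (H (s x) (W_s x Hx)) as H'.
    rewrite (position_inv T s W R) in H'; auto. lia.
  - intros E. now rewrite (proj2 (Z.eqb_eq _ _) E).
Qed.

Lemma coordinates_inv x : W x -> coordinates (s x) = opp (coordinates x).
Proof.
  intros Hx. unfold coordinates, opp. simpl.
  rewrite !(position_inv T s W R); auto. f_equal.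
  generalize (position T R Lv x) (position T R S x). clear. intros a b.
  destruct (Z.eqb_spec (a mod 2) 0), (Z.eqb_spec (- a mod 2) 0); parity.
Qed.

(** If [y] were strictly below [x] with equal coordinates, an entry would separate them: a level
    equivalent to [x] when the position is even, [x] itself as a member of [S] when it is odd. *)
Lemma coordinates_lex x y :
  In x S -> In y S -> (lex (coordinates x) (coordinates y) <-> R x y).
Proof.
  intros Sx Sy. pose proof (S_W x Sx) as Hx. pose proof (S_W y Sy) as Hy.
  assert (mono : forall x y, W x -> W y -> R x y -> lex (coordinates x) (coordinates y)).
  { clear x y Sx Sy Hx Hy. intros x y Hx Hy H.
    pose proof (position_mono T W R R_trans R_total Lv Lv_W x y Hx Hy H).
    pose proof (position_mono T W R R_trans R_total S S_W x y Hx Hy H).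
    unfold lex, coordinates. simpl.
    destruct (Z.eq_dec (position T R Lv x) (position T R Lv y)) as [E|E]; [right | left; lia].
    rewrite <- E. destruct (_ =? _); lia. }
  split; [| now apply mono].
  intros H. apply NNPP. intros Hn.
  assert (Hyx : R y x) by (destruct (R_total x y Hx Hy); tauto).
  pose proof (mono y x Hy Hx Hyx) as H'.
  assert (E : coordinates x = coordinates y).
  { destruct (coordinates x), (coordinates y). unfold lex in H, H'. simpl in *.
    f_equal; lia. }
  unfold coordinates in E. injection E as E1 E2. rewrite <- E1 in E2.
  destruct (Z.eqb_spec (position T R Lv x mod 2) 0) as [Ev|Ev].
  - apply (position_even_iff x Hx) in Ev as (l & Hl & H1 & H3).
    assert (R y l) by (apply R_trans with x; auto).
    pose proof (position_strict T W R R_trans R_total Lv Lv_W y x l Hy Hx Hl).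
    intuition lia.
  - pose proof (position_strict T W R R_trans R_total S S_W y x x Hy Hx Sx Hyx).
    destruct (R_total x x Hx Hx); intuition lia.
Qed.

Lemma coordinates_bounded x :
  Z.abs (snd (coordinates x)) <= Z.of_nat (length S).
Proof.
  clear. unfold coordinates. simpl. pose proof (position_abs T R S x).
  destruct (_ =? _); lia.
Qed.

End Coordinates.

(** * Two facts on finite lists *)

Lemma ForallOrdPairs_impl_in (T : Type) (P Q : T -> T -> Prop) (L : list T) :
  (forall x y, In x L -> In y L -> P x y -> Q x y) ->
  ForallOrdPairs P L -> ForallOrdPairs Q L.
Proof.
  intros H HL. induction HL as [|a L Ha HL IH]; [constructor|].
  constructor.
  - rewrite Forall_forall in *. intros x Hx. apply H; simpl; auto.
  - apply IH. intros; apply H; simpl; auto.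
Qed.

Lemma finite_choice (S T : Type) (Q : S -> Prop) (G : T -> Prop)
    (P : S -> T -> Prop) (L : list S) :
  (forall a, Q a -> exists b, G b /\ P a b) ->
  exists bs, (forall b, In b bs -> G b) /\
    forall a, In a L -> Q a -> exists b, In b bs /\ P a b.
Proof.
  intros H. induction L as [|a L (bs & HG & HP)].
  - exists []. split; [intros b [] | intros a []].
  - destruct (classic (Q a)) as [Ha|Ha].
    + destruct (H a Ha) as (b & Gb & Pb). exists (b :: bs). split.
      * intros b' [<-|Hb]; auto.
      * intros a' [<-|Ha'] Qa'; [exists b; simpl; auto|].
        destruct (HP a' Ha' Qa') as (b' & Hb' & Pb'). exists b'. simpl. auto.
    + exists bs. split; [exact HG|].
      intros a' [<-|Ha'] Qa'; [tauto | auto].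
Qed.

(** * Adjoining a virtual fixed point *)

(** [None] stands for a fixed point of the involution; [x] lies below it when
    [x] lies below [inv x]. *)
Definition below (A : gs_algebra) (b : A) (x y : option A) : Prop :=
  match x, y with
  | Some x, Some y => le_at A b x y
  | Some x, None => le_at A b x (inv x)
  | None, Some y => le_at A b (inv y) y
  | None, None => True
  end.

Section Below.
Variables (A : gs_algebra) (b : A) (V : list A).
Hypothesis gsA : is_gs A.
Hypothesis b_compl : complemented A b.
Hypothesis V_inv : forall x, In x V -> In (inv x) V.
Hypothesis b_decided : forall x y, In x V -> In y V -> decided A b x y.

Definition among (x : option A) : Prop :=
  match x with Some x => In x V | None => True end.

Definition option_inv : option A -> option A := option_map inv.

Lemma option_inv_invol x : option_inv (option_inv x) = x.
Proof. destruct x as [x|]; [| reflexivity]. simpl. now rewrite (invI A gsA). Qed.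

Lemma among_inv x : among x -> among (option_inv x).
Proof. destruct x as [x|]; simpl; auto. Qed.

Lemma le_at_inv x y : le_at A b x y -> le_at A b (inv y) (inv x).
Proof. apply (meet_inv_swap A gsA). exact b_compl. Qed.

Lemma below_total x y : among x -> among y -> below A b x y \/ below A b y x.
Proof.
  destruct x as [x|], y as [y|]; simpl; intros Hx Hy; auto;
    apply (decided_total A gsA); auto.
Qed.

Lemma below_anti x y :
  among x -> among y -> below A b x y -> below A b (option_inv y) (option_inv x).
Proof.
  destruct x as [x|], y as [y|]; simpl; intros Hx Hy H; auto;
    try rewrite (invI A gsA); auto using le_at_inv.
Qed.

Lemma below_trans x y z :
  among x -> among y -> among z -> below A b x y -> below A b y z -> below A b x z.
Proof.
  pose proof (le_at_trans A gsA b) as tr. pose proof le_at_inv as anti.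
  destruct x as [x|], y as [y|], z as [z|]; simpl; intros Hx Hy Hz H1 H2; auto;
    try now eauto.
  (* [x] and [z] lie on opposite sides of the fixed point: if [z] were below [x],
     then [x <= inv x <= inv z <= z]. *)
  destruct (decided_total A gsA b x z (b_decided x z Hx Hz)) as [H|H]; eauto.
Qed.

End Below.

(** * From a failing inequality to a partial embedding *)

Section PartialEmbedding.
Variable M : mgs_algebra.
Hypothesis cmgsM : is_cmgs M.
Let mgsM := cmgs_mgs M cmgsM.
Let gsM := mgs_gs M mgsM.

Variable V : list M.
Hypothesis V_sym : Permutation (map inv V) V.
Hypothesis V_top : In top V.

Lemma V_inv x : In x V -> In (inv x) V.
Proof.
  intros H. apply (Permutation_in _ V_sym). now apply in_map.
Qed.

Variables x0 y0 : M.
Hypothesis x0_V : In x0 V.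
Hypothesis y0_V : In y0 V.
Hypothesis not_le0 : ~ le x0 y0.

Definition quantified_in : list M :=
  filter (fun k => if excluded_middle_informative (quantified M k) then true else false) V.

Lemma in_quantified_in k : In k quantified_in <-> In k V /\ quantified M k.
Proof.
  unfold quantified_in. rewrite filter_In.
  destruct excluded_middle_informative; intuition discriminate.
Qed.

Lemma all_quantified_in x : In (all x) V -> In (all x) quantified_in.
Proof.
  intros H. apply in_quantified_in. split; [exact H | apply (quantified_all M mgsM)].
Qed.

Lemma quantified_in_inv k : In k quantified_in -> In (inv k) quantified_in.
Proof.
  rewrite !in_quantified_in. intros [H1 H2].
  split; [now apply V_inv | now apply (quantified_inv M mgsM)].
Qed.

(** The search starts from [neg (delta w)] with [w = all (x0 ⇒ y0)]. It is nonzero because [w] lies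
    below [x0 ⇒ y0], which is not top, and it is quantified because [w] is. No state below it lies
    below [w]. *)
Lemma exists_base_state : exists u, state M u /\ quantified M u /\
  ~ le u (all (x0 ⇒ y0)) /\
  forall k l, In k quantified_in -> In l quantified_in -> decided M u k l.
Proof.
  set (w := all (x0 ⇒ y0)).
  assert (Hw : ~ le top (delta M w)).
  { intros H. apply not_le0. apply (imp_eq_top M gsM), (top_le M gsM).
    eapply (le_trans M gsM); [exact H|].
    eapply (le_trans M gsM); [apply (delta_le M gsM) | apply (all_le M mgsM)]. }
  destruct (decide_pairs M gsM (quantified M) (neg (delta M w))
      (list_prod quantified_in quantified_in))
    as (u & Su & Qu & Hu & Hd).
  - intros x y Hx Hy. apply (quantified_meet M mgsM); [exact Hx|].
    now apply (quantified_neg M mgsM), (quantified_delta M mgsM).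
  - split; [apply (complemented_neg M gsM)|]. intros E. apply Hw.
    rewrite <- (negneg_complemented M gsM) by apply (complemented_delta M gsM).
    apply (le_neg M gsM). rewrite E. apply (meet_le_r M gsM).
  - apply (quantified_neg M mgsM), (quantified_delta M mgsM), (quantified_all M mgsM).
  - intros [k l] H. apply in_prod_iff in H as [Hk Hl]. apply in_quantified_in in Hk, Hl.
    now apply (quantified_imp M mgsM).
  - exists u. repeat split; try apply Su; auto.
    + intros H. apply (proj2 Su). apply (le_neg_bot M gsM u (delta M w)); [| exact Hu].
      apply (le_delta M gsM); [apply Su | exact H].
    + intros k l Hk Hl. apply (Hd (k, l)). now apply in_prod.
Qed.

Section OverBase.
Variable u : M.
Hypothesis u_state : state M u.
Hypothesis u_quantified : quantified M u.
Hypothesis u_not_le0 : ~ le u (all (x0 ⇒ y0)).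
Hypothesis u_decided : forall k l, In k quantified_in -> In l quantified_in -> decided M u k l.

Definition good (b : M) : Prop :=
  state M b /\ le b u /\ forall x y, In x V -> In y V -> decided M b x y.

(** The quantifier is removed by [witness_state], and the resulting state is refined until it
    settles all of [V]; the refinement keeps it below [neg (delta (x ⇒ y))]. *)
Lemma exists_good x y :
  ~ le u (all (x ⇒ y)) -> exists b, good b /\ ~ le_at M b x y.
Proof.
  intros H. pose proof (witness_state M mgsM u (x ⇒ y) u_state u_quantified H) as Sc.
  destruct (decide_pairs M gsM (fun _ => True) _ (list_prod V V)
    (fun _ _ _ _ => Logic.I) Sc Logic.I (fun _ _ => Logic.I)) as (b & Sb & _ & Hb & Hd).
  exists b. split.
  - split; [exact Sb | split].
    + eapply (le_trans M gsM); [exact Hb | apply (meet_le_l M gsM)].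
    + intros z w Hz Hw. apply (Hd (z, w)). now apply in_prod.
  - apply (not_le_at M gsM); [exact Sb|].
    eapply (le_trans M gsM); [exact Hb | apply (meet_le_r M gsM)].
Qed.

Lemma exists_witnesses : exists bs : list M,
  (forall b, In b bs -> good b) /\
  forall x y, In x V -> In y V -> ~ le u (all (x ⇒ y)) ->
    exists b, In b bs /\ ~ le_at M b x y.
Proof.
  destruct (finite_choice (M * M) M (fun p => ~ le u (all (fst p ⇒ snd p))) good
    (fun p b => ~ le_at M b (fst p) (snd p)) (list_prod V V)) as (bs & HG & HP).
  - intros [x y]. apply exists_good.
  - exists bs. split; [exact HG|]. intros x y Hx Hy. apply (HP (x, y)).
    now apply in_prod.
Qed.

(** A negative decision at [u] passes to the nonzero [b], so comparisons of quantified elements are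
    the same at [u] and at each place. Comparisons with the virtual level reduce to those of [k]
    with [inv k]. *)
Lemma below_base k l b :
  good b -> among M quantified_in k -> among M quantified_in l ->
  (below M b k l <-> below M u k l).
Proof.
  intros (Sb & Hb & _).
  assert (H : forall k l, In k quantified_in -> In l quantified_in ->
    (le_at M b k l <-> le_at M u k l)).
  { clear k l. intros k l Hk Hl. split; [| now apply (le_at_mono M gsM)].
    intros H. destruct (u_decided k l Hk Hl) as [H'|H']; [exact H'|].
    destruct (not_le_at M gsM b k l Sb); [| exact H].
    eapply (le_trans M gsM); eauto. }
  destruct k as [k|], l as [l|]; simpl; intros Hk Hl; try tauto;
    apply H; auto using quantified_in_inv.
Qed.

(** For the virtual level this is axiom (C); for the others, (M3). *)
Lemma not_below_all x l :
  In x V -> among M quantified_in l -> ~ below M u l (Some (all x)) ->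
  exists y, In y V /\ ~ le u (all (y ⇒ x)) /\
    forall b, below M b l (Some x) -> le_at M b y x.
Proof.
  intros Hx. destruct l as [k|]; simpl; intros Hk Hn.
  - apply in_quantified_in in Hk as [Hk Qk]. exists k. split; [exact Hk | split; [| auto]].
    now rewrite (all_imp M mgsM), <- (le_at_imp M gsM).
  - exists (inv x). split; [now apply V_inv | split; [| auto]].
    intros H. apply Hn. apply (all_above_inv M mgsM).
    + apply (MC M cmgsM).
    + apply u_state.
    + exact u_quantified.
    + apply (le_at_imp M gsM). eapply (le_trans M gsM); [exact H | apply (all_le M mgsM)].
Qed.

Section OverWitnesses.
Variable bs : list M.
Hypothesis bs_good : forall b, In b bs -> good b.
Hypothesis bs_witness : forall x y, In x V -> In y V -> ~ le u (all (x ⇒ y)) ->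
  exists b, In b bs /\ ~ le_at M b x y.

Variables (Lv : list (option M)) (m : nat).
Hypothesis Lv_K : forall l, In l Lv -> among M quantified_in l.
Hypothesis Lv_distinct_u : distinct (option M) (below M u) Lv.
Hypothesis Lv_sym : symmetric (option M) (option_inv M) Lv.
Hypothesis Lv_cover_u : forall k, In k quantified_in ->
  exists l, In l Lv /\ equiv (option M) (below M u) (Some k) l.
Hypothesis Lv_length : length Lv = (2 * m + 1)%nat.

Definition index : Type := {b : M | In b bs}.

Definition val (i : index) : M := proj1_sig i.

Definition height (i : index) (x : M) : Z :=
  position (option M) (below M (val i)) Lv (Some x).

Definition coords (i : index) (x : M) : Z * Z :=
  coordinates (option M) (below M (val i)) Lv (map Some V) (Some x).

Lemma val_good i : good (val i).
Proof. exact (bs_good _ (proj2_sig i)). Qed.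

Lemma trans_i i : forall x y z, among M V x -> among M V y -> among M V z ->
  below M (val i) x y -> below M (val i) y z -> below M (val i) x z.
Proof.
  apply below_trans; auto using V_inv; [apply (val_good i) | apply (val_good i)].
Qed.

Lemma total_i i : forall x y, among M V x -> among M V y ->
  below M (val i) x y \/ below M (val i) y x.
Proof. apply below_total; auto using V_inv. apply (val_good i). Qed.

Lemma anti_i i : forall x y, among M V x -> among M V y ->
  below M (val i) x y -> below M (val i) (option_inv M y) (option_inv M x).
Proof. apply below_anti; auto. apply (val_good i). Qed.

Lemma Lv_V l : In l Lv -> among M V l.
Proof.
  intros H. apply Lv_K in H. destruct l as [k|]; simpl in *; [| auto].
  now apply in_quantified_in in H.
Qed.

Lemma S_V l : In l (map Some V) -> among M V l.
Proof. intros H. apply in_map_iff in H as (x & <- & Hx). exact Hx. Qed.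

Lemma S_sym : symmetric (option M) (option_inv M) (map Some V).
Proof.
  unfold symmetric. rewrite map_map.
  change (fun x : M => option_inv M (Some x)) with (fun x : M => Some (inv x)).
  rewrite <- (map_map inv Some). now apply Permutation_map.
Qed.

Lemma Lv_distinct i : distinct (option M) (below M (val i)) Lv.
Proof.
  unfold distinct. eapply ForallOrdPairs_impl_in; [| exact Lv_distinct_u].
  intros x y Hx Hy. unfold equiv.
  now rewrite !(below_base _ _ _ (val_good i)) by auto.
Qed.

Lemma Lv_cover i k : In k quantified_in ->
  exists l, In l Lv /\ equiv (option M) (below M (val i)) (Some k) l.
Proof.
  intros Hk. destruct (Lv_cover_u k Hk) as (l & Hl & E). exists l. split; [exact Hl|].
  unfold equiv. now rewrite !(below_base _ _ _ (val_good i)) by auto.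
Qed.

Lemma top_quantified_in : In top quantified_in.
Proof. apply in_quantified_in. split; [exact V_top | apply (all_top M mgsM)]. Qed.

Lemma top_max_i i x : among M V x -> below M (val i) x (Some top).
Proof.
  destruct x as [x|]; simpl; intros _; apply (le_at_of_le M gsM), (top_max M gsM).
Qed.

Lemma coords_point i x : In x V -> is_point m (coords i x).
Proof.
  intros Hx.
  apply (coordinates_point _ (option_inv M) (among M V) (below M (val i)))
    with (t := Some top); try exact (trans_i i);
    auto using total_i, anti_i, Lv_V, Lv_distinct, top_max_i.
  - apply option_inv_invol, gsM.
  - intros y. apply among_inv, V_inv.
  - apply Lv_cover, top_quantified_in.
Qed.

Lemma coords_lex i x y :
  In x V -> In y V -> (lex (coords i x) (coords i y) <-> le_at M (val i) x y).
Proof.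
  intros Hx Hy.
  apply (coordinates_lex _ (among M V) (below M (val i)) (trans_i i) (total_i i)
    Lv (map Some V) m Lv_V S_V (Lv_distinct i) Lv_length (Some x) (Some y));
    now apply in_map.
Qed.

Lemma coords_inv i x : In x V -> coords i (inv x) = opp (coords i x).
Proof.
  intros Hx. unfold coords. change (Some (inv x)) with (option_inv M (Some x)).
  apply (coordinates_inv _ (option_inv M) (among M V) (below M (val i)));
    auto using anti_i, Lv_V, S_V, S_sym.
  - apply option_inv_invol, gsM.
  - intros y. apply among_inv, V_inv.
Qed.

Lemma coords_top i : coords i top = (2 * Z.of_nat m, 0).
Proof.
  apply (coordinates_top _ (among M V) (below M (val i)));
    try exact (trans_i i); auto using total_i, Lv_V, Lv_distinct, top_max_i.
  apply Lv_cover, top_quantified_in.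
Qed.

Lemma origin_bound : Z.abs 0 <= 2 * Z.of_nat m.
Proof. lia. Qed.

(** Elements outside [V] are sent to the junk value [(0, 0)]. *)
Definition place (i : index) (x : M) : levels m :=
  match excluded_middle_informative (In x V) with
  | left H => exist _ (coords i x) (coords_point i x H)
  | right _ => level m 0 origin_bound
  end.

Lemma place_coords i x : In x V -> proj1_sig (place i x) = coords i x.
Proof.
  intros Hx. unfold place. destruct excluded_middle_informative; [reflexivity | tauto].
Qed.

Lemma rank_place i x : In x V -> rank m (place i x) = height i x.
Proof. intros Hx. unfold rank. now rewrite place_coords. Qed.

Lemma place_lex i x y :
  In x V -> In y V -> (lex_point m (place i x) (place i y) <-> le_at M (val i) x y).
Proof.
  intros Hx Hy. unfold lex_point. rewrite !place_coords by auto. now apply coords_lex.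
Qed.

Lemma place_eq i x y :
  In x V -> In y V -> le_at M (val i) x y -> le_at M (val i) y x ->
  place i x = place i y.
Proof.
  intros Hx Hy H1 H2. apply lex_point_antisym; now apply place_lex.
Qed.

Lemma place_join i x y :
  In x V -> In y V -> In (x ⊔ y) V -> place i (x ⊔ y) = place i x ⊔ place i y.
Proof.
  intros Hx Hy Hxy. simpl.
  destruct excluded_middle_informative as [H|H]; rewrite place_lex in H by auto.
  - apply place_eq; auto.
    + apply (le_at_join M gsM); [exact H | apply (le_at_of_le M gsM), (le_refl M gsM)].
    + apply (le_at_of_le M gsM), (le_join_r M gsM).
  - apply place_eq; auto.
    + apply (le_at_join M gsM); [apply (le_at_of_le M gsM), (le_refl M gsM)|].
      destruct (total_i i (Some x) (Some y) Hx Hy); tauto.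
    + apply (le_at_of_le M gsM), (le_join_l M gsM).
Qed.

Lemma place_meet i x y :
  In x V -> In y V -> In (x ⊓ y) V -> place i (x ⊓ y) = place i x ⊓ place i y.
Proof.
  intros Hx Hy Hxy. simpl.
  destruct excluded_middle_informative as [H|H]; rewrite place_lex in H by auto.
  - apply place_eq; auto; [apply (le_at_of_le M gsM), (meet_le_l M gsM)|].
    apply (le_meet M gsM); [apply (meet_le_r M gsM) | exact H].
  - apply place_eq; auto; [apply (le_at_of_le M gsM), (meet_le_r M gsM)|].
    apply (le_meet M gsM); [| apply (meet_le_r M gsM)].
    destruct (total_i i (Some x) (Some y) Hx Hy); tauto.
Qed.

Lemma place_top i : place i top = top.
Proof.
  apply proj1_sig_inj. rewrite place_coords by exact V_top. apply coords_top.
Qed.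

Lemma place_imp i x y :
  In x V -> In y V -> In (x ⇒ y) V -> place i (x ⇒ y) = (place i x ⇒ place i y).
Proof.
  intros Hx Hy Hxy. pose proof (place_top i) as Et. simpl.
  destruct excluded_middle_informative as [H|H]; rewrite place_lex in H by auto.
  - simpl in Et. rewrite <- Et. apply place_eq; auto.
    + apply (le_at_of_le M gsM), (top_max M gsM).
    + unfold le_at. apply (le_at_imp M gsM) in H.
      eapply (le_trans M gsM); [apply (meet_le_l M gsM) | exact H].
  - apply place_eq; auto.
    + destruct (val_good i) as (_ & _ & Hd).
      destruct (decided_imp M gsM (val i) x y (Hd x y Hx Hy)); tauto.
    + apply (le_at_of_le M gsM), (le_imp M gsM), (meet_le_l M gsM).
Qed.

Lemma place_inv i x : In x V -> place i (inv x) = inv (place i x).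
Proof.
  intros Hx. apply proj1_sig_inj. simpl.
  rewrite !place_coords by auto using V_inv. now apply coords_inv.
Qed.

Lemma place_bot i : place i bot = bot.
Proof.
  rewrite <- (inv_top M gsM), place_inv by exact V_top.
  rewrite place_top. apply (inv_top (levels m)), levels_gs.
Qed.

Lemma height_base i k : In k quantified_in ->
  height i k = position (option M) (below M u) Lv (Some k).
Proof.
  intros Hk. apply position_ext. intros l Hl.
  now rewrite !(below_base _ _ _ (val_good i)) by (simpl; auto).
Qed.

Lemma even_height i k : In k quantified_in -> height i k mod 2 = 0.
Proof.
  intros Hk.
  apply (position_even_iff _ (among M V) (below M (val i)) (trans_i i) (total_i i)
    Lv m Lv_V (Lv_distinct i) Lv_length (Some k)).
  - simpl. now apply in_quantified_in in Hk.
  - now apply Lv_cover.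
Qed.

(** The first coordinate depends only on comparisons that [u] has settled; it is even, so the second
    is 0. *)
Lemma place_base i j k : In k quantified_in -> place i k = place j k.
Proof.
  intros Hk. assert (Vk : In k V) by now apply in_quantified_in in Hk.
  apply point_eq.
  - change (rank m (place i k) = rank m (place j k)).
    now rewrite !rank_place, !height_base by auto.
  - rewrite !place_coords by auto. unfold coords, coordinates. simpl.
    pose proof (even_height i k Hk) as E. pose proof (even_height j k Hk) as E'.
    unfold height in E, E'. now rewrite (proj2 (Z.eqb_eq _ _) E), (proj2 (Z.eqb_eq _ _) E').
Qed.

Lemma index_finite : Finite index.
Proof.
  destruct (finite_sig M (fun b => In b bs) bs) as [l Hl].
  exists l. intros i. apply Hl, proj2_sig.
Qed.

Lemma exists_index x y :
  In x V -> In y V -> ~ le u (all (x ⇒ y)) -> exists i, ~ le_at M (val i) x y.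
Proof.
  intros Hx Hy H. destruct (bs_witness x y Hx Hy H) as (b & Hb & Hn).
  now exists (exist _ b Hb).
Qed.

Lemma index_inhabited : inhabited index.
Proof.
  destruct (exists_index x0 y0 x0_V y0_V u_not_le0) as [i _]. exact (inhabits i).
Qed.

(** The place [i] is the one where [x] is lowest. A level below [x] there but not below [all x]
    would, by [not_below_all], lie strictly above [x] at some place [j], and [x] would be lower at
    [j] than at [i]. *)
Lemma height_all x :
  In x V -> In (all x) V -> exists i, height i x <= height i (all x) + 1.
Proof.
  intros Hx Hax.
  pose proof (all_quantified_in x Hax) as Ka.
  destruct (exists_min index (fun i => height i x) index_finite index_inhabited) as [i Hi].
  exists i.
  (* [all x] is equivalent to exactly one level; this 1 is the [+ 1] of the goal, the step from a
     level into the gap above it. *)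
  assert (E : multiplicity (option M) (below M (val i)) Lv (Some (all x)) = 1).
  { apply (multiplicity_distinct _ (among M V) (below M (val i)) (trans_i i)
      Lv Lv_V (Some (all x)) (Lv_distinct i) Hax).
    now apply Lv_cover. }
  rewrite <- E.
  apply (position_floor _ (among M V) (below M (val i)) (total_i i) Lv Lv_V);
    [exact Hx | exact Hax |].
  intros l Hl Hlx. apply NNPP. intros Hn.
  rewrite (below_base _ _ _ (val_good i)) in Hn by auto.
  destruct (not_below_all x l Hx (Lv_K l Hl) Hn) as (y & Hy & Hny & Hyx).
  destruct (exists_index y x Hy Hx Hny) as [j Hj].
  assert (Hlj : ~ below M (val j) l (Some x)) by (intros H; apply Hj, Hyx, H).
  assert (Hxl : below M (val j) (Some x) l).
  { destruct (total_i j (Some x) l); auto using Lv_V. tauto. }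
  assert (Hll : below M (val j) l l) by (destruct (total_i j l l); auto using Lv_V).
  pose proof (position_strict _ (among M V) (below M (val j)) (trans_i j) (total_i j)
    Lv Lv_V (Some x) l l Hx (Lv_V l Hl) Hl Hxl Hll Hlj) as H1.
  pose proof (position_mono _ (among M V) (below M (val i)) (trans_i i) (total_i i)
    Lv Lv_V l (Some x) (Lv_V l Hl) Hx Hlx) as H2.
  assert (E' : position (option M) (below M (val i)) Lv l =
    position (option M) (below M (val j)) Lv l).
  { apply position_ext. intros l' Hl'.
    now rewrite !(below_base _ _ _ (val_good i)), !(below_base _ _ _ (val_good j)) by auto. }
  specialize (Hi j). unfold height in Hi. lia.
Qed.

Let N := Z.of_nat (length (map Some V)).

Lemma N_ge0 : 0 <= N.
Proof. unfold N. lia. Qed.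

Lemma shift_zero (a : point m) : shift_point m 0 a = a.
Proof.
  apply point_eq; [reflexivity|]. simpl. destruct (_ =? _); lia.
Qed.

Lemma family_place x :
  family m index N (fun p => shift_point m (snd p) (place (fst p) x)).
Proof.
  intros i. simpl. rewrite shift_zero. split; [| reflexivity].
  unfold bounded, place. destruct excluded_middle_informative as [H|H].
  - apply coordinates_bounded.
  - simpl. apply N_ge0.
Qed.

Let F := family_model m index N index_finite index_inhabited N_ge0.

Definition embed (x : M) : F := exist _ _ (family_place x).

(** The value of [all x] is a level common to all places. It meets the criterion of [is_inf_family]
    at the place given by [height_all], and infima are unique. *)
Lemma embed_all x : In x V -> In (all x) V -> embed (all x) = all (embed x).
Proof.
  intros Hx Hax.
  pose proof (all_quantified_in x Hax) as Ka.
  pose proof index_inhabited as inh. destruct inh as [i0].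
  destruct (family_all_spec m index N index_finite index_inhabited N_ge0 (embed x))
    as (a & Ha & Ea).
  assert (E : a = place i0 (all x)).
  { apply (is_inf_unique (levels m) (levels_gs m) _ _ _ _ Ha).
    destruct (height_all x Hx Hax) as [i Hi].
    apply (is_inf_family m index N _ _ i).
    - apply family_place.
    - rewrite rank_place by exact Hax. now apply even_height.
    - intros j. simpl. rewrite shift_zero, !rank_place by auto.
      rewrite (height_base i0), <- (height_base j) by exact Ka.
      apply (position_mono _ (among M V) (below M (val j)) (trans_i j) (total_i j)
        Lv Lv_V); auto.
      apply (le_at_of_le M gsM), (all_le M mgsM).
    - simpl. rewrite shift_zero, !rank_place by auto.
      now rewrite (height_base i0), <- (height_base i) by exact Ka. }
  apply proj1_sig_inj. refine (eq_trans _ (eq_sym Ea)). rewrite E.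
  extensionality p. destruct p as [i j]. simpl.
  rewrite (place_base i i0) by exact Ka. apply shift_fixes_level.
  rewrite rank_place by exact Hax. now apply even_height.
Qed.

(** No clause treats [ex], which is [inv (all (inv x))] in both algebras. The elements [x0] and [y0]
    are separated at a witnessing place with shift 0. *)
Lemma exists_partial_embedding_over : exists (N : mgs_algebra) (h : M -> N),
  (is_functional N /\ Finite N /\ has_fixed_point N) /\
  (forall x y, In x V -> In y V -> In (x ⊔ y) V -> h (x ⊔ y) = h x ⊔ h y) /\
  (forall x y, In x V -> In y V -> In (x ⊓ y) V -> h (x ⊓ y) = h x ⊓ h y) /\
  (forall x y, In x V -> In y V -> In (x ⇒ y) V -> h (x ⇒ y) = (h x ⇒ h y)) /\
  (forall x, In x V -> h (inv x) = inv (h x)) /\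
  (forall x, In x V -> In (all x) V -> h (all x) = all (h x)) /\
  h bot = bot /\ h top = top /\ h x0 <> h y0.
Proof.
  exists F, embed.
  repeat match goal with |- _ /\ _ => split end.
  - apply family_model_functional.
  - apply family_model_finite.
  - apply family_model_fixed_point.
  - intros x y Hx Hy H. apply proj1_sig_inj. extensionality p. simpl.
    rewrite place_join by auto. apply shift_join.
  - intros x y Hx Hy H. apply proj1_sig_inj. extensionality p. simpl.
    rewrite place_meet by auto. apply shift_meet.
  - intros x y Hx Hy H. apply proj1_sig_inj. extensionality p. simpl.
    rewrite place_imp by auto. apply shift_imp.
  - intros x Hx. apply proj1_sig_inj. extensionality p. simpl.
    rewrite place_inv by auto. apply shift_inv.
  - apply embed_all.
  - apply proj1_sig_inj. extensionality p. simpl.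
    rewrite place_bot. apply shift_fixes_level, even_bot.
  - apply proj1_sig_inj. extensionality p. simpl.
    rewrite place_top. apply shift_fixes_level, even_top.
  - intros E. destruct (exists_index x0 y0 x0_V y0_V u_not_le0) as [i Hi].
    apply Hi. apply place_lex; auto.
    pose proof (f_equal (fun f => proj1_sig f (i, 0)) E) as E'. simpl in E'.
    rewrite !shift_zero in E'. rewrite E'. unfold lex_point, lex. lia.
Qed.

End OverWitnesses.
End OverBase.

End PartialEmbedding.

Lemma exists_partial_embedding (M : mgs_algebra) (V : list M) (x0 y0 : M) :
  is_cmgs M -> Permutation (map inv V) V -> In top V ->
  In x0 V -> In y0 V -> ~ le x0 y0 ->
  exists (N : mgs_algebra) (h : M -> N),
  (is_functional N /\ Finite N /\ has_fixed_point N) /\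
  (forall x y, In x V -> In y V -> In (x ⊔ y) V -> h (x ⊔ y) = h x ⊔ h y) /\
  (forall x y, In x V -> In y V -> In (x ⊓ y) V -> h (x ⊓ y) = h x ⊓ h y) /\
  (forall x y, In x V -> In y V -> In (x ⇒ y) V -> h (x ⇒ y) = (h x ⇒ h y)) /\
  (forall x, In x V -> h (inv x) = inv (h x)) /\
  (forall x, In x V -> In (all x) V -> h (all x) = all (h x)) /\
  h bot = bot /\ h top = top /\ h x0 <> h y0.
Proof.
  intros cmgsM V_sym V_top Hx0 Hy0 Hn.
  pose proof (mgs_gs M (cmgs_mgs M cmgsM)) as gsM.
  pose proof (quantified_in_inv M cmgsM V V_sym) as K_inv.
  destruct (exists_base_state M cmgsM V x0 y0 Hn) as (u & Su & Qu & Hu & Du).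
  destruct (exists_witnesses M cmgsM V u Su Qu) as (bs & HG & HP).
  (* [None] is the fixed entry, so there is a middle level whether or not [M] has a fixed point. *)
  destruct (exists_levels (option M) (option_inv M) None
      (among M (quantified_in M V)) (below M u))
    with (L0 := map Some (quantified_in M V)) as (Lv & m & HL & Hd & Hs & Hc & Hm).
  - apply option_inv_invol, gsM.
  - reflexivity.
  - exact Logic.I.
  - intros x. now apply among_inv.
  - apply below_trans; auto; apply Su.
  - now apply below_total.
  - apply below_anti; auto; apply Su.
  - intros x H. now apply in_map_iff in H as (k & <- & Hk).
  - apply (exists_partial_embedding_over M cmgsM V V_sym V_top x0 y0 Hx0 Hy0
      u Su Qu Hu Du bs HG HP Lv m); auto.
    + intros l Hl. destruct (HL l Hl) as [->|[H|H]]; [exact Logic.I | |].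
      * now apply in_map_iff in H as (k & <- & Hk).
      * apply in_map_iff in H as (k & E & Hk). rewrite <- (option_inv_invol M gsM l).
        rewrite <- E. simpl. auto.
    + intros k Hk. apply Hc. right. now apply in_map.
Qed.

(** * Quasi-identities *)

(** [Ex] is traded for [All] and [Inv], so its translate counts as a subterm. *)
Fixpoint subterms (t : term) : list term :=
  t :: match t with
  | Join s t | Meet s t | Imp s t => subterms s ++ subterms t
  | Inv t | All t => subterms t
  | Ex t => All (Inv t) :: Inv t :: subterms t
  | Var _ | Bot | Top => []
  end.

Lemma in_subterms t : In t (subterms t).
Proof. destruct t; now left. Qed.

Lemma eval_partial_embedding (M N : mgs_algebra) (V : list M) (h : M -> N) (v : nat -> M) :
  is_mgs M -> is_mgs N -> (forall x, In x V -> In (inv x) V) ->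
  (forall x y, In x V -> In y V -> In (x ⊔ y) V -> h (x ⊔ y) = h x ⊔ h y) ->
  (forall x y, In x V -> In y V -> In (x ⊓ y) V -> h (x ⊓ y) = h x ⊓ h y) ->
  (forall x y, In x V -> In y V -> In (x ⇒ y) V -> h (x ⇒ y) = (h x ⇒ h y)) ->
  (forall x, In x V -> h (inv x) = inv (h x)) ->
  (forall x, In x V -> In (all x) V -> h (all x) = all (h x)) ->
  h bot = bot -> h top = top ->
  forall t, incl (map (eval M v) (subterms t)) V ->
  eval N (fun n => h (v n)) t = h (eval M v t).
Proof.
  intros mgsM mgsN Hinv Ej Em Ei En Ea E0 E1 t.
  induction t as [n|s IHs t IHt|s IHs t IHt|s IHs t IHt|t IHt|t IHt|t IHt| |];
    simpl; intros HV; auto.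
  1-3: rewrite map_app in HV;
    apply incl_cons_inv in HV as [H0 HV]; apply incl_app_inv in HV as [Hs Ht];
    rewrite IHs, IHt by assumption; symmetry;
    assert (In (eval M v s) V) by (apply Hs, in_map, in_subterms);
    assert (In (eval M v t) V) by (apply Ht, in_map, in_subterms); auto.
  - apply incl_cons_inv in HV as [H0 HV]. rewrite IHt by exact HV.
    symmetry. apply En, HV, in_map, in_subterms.
  - apply incl_cons_inv in HV as [H0 HV]. apply incl_cons_inv in HV as [H1 HV].
    apply incl_cons_inv in HV as [H2 HV]. simpl in H1, H2.
    rewrite IHt by exact HV. rewrite (ex_all M mgsM), (ex_all N mgsN).
    rewrite En, Ea, En; auto. apply HV, in_map, in_subterms.
  - apply incl_cons_inv in HV as [H0 HV]. rewrite IHt by exact HV.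
    symmetry. apply Ea; [apply HV, in_map, in_subterms | exact H0].
Qed.

Lemma quasi_identity_of_finite (q : quasi_identity) :
  (forall N, is_functional N /\ Finite N /\ has_fixed_point N -> satisfies N q) ->
  forall M, is_cmgs M -> satisfies M q.
Proof.
  intros Hq M cmgsM v Hv. apply NNPP. intros Hn.
  pose proof (cmgs_mgs M cmgsM) as mgsM. pose proof (mgs_gs M mgsM) as gsM.
  set (ts := Top :: flat_map (fun e => subterms (fst e) ++ subterms (snd e))
    (conclusion q :: premises q)).
  (* Appending the images under [inv] makes [V] invariant as a list with multiplicities, as the
     symmetry of positions requires. *)
  set (V0 := map (eval M v) ts). set (V := V0 ++ map inv V0).
  assert (V_sym : Permutation (map inv V) V).
  { unfold V. rewrite map_app, map_map.
    rewrite (map_ext (fun x : M => inv (inv x)) (fun x => x) (invI M gsM)), map_id.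
    apply Permutation_app_comm. }
  assert (V_terms : forall e, In e (conclusion q :: premises q) ->
    incl (map (eval M v) (subterms (fst e))) V /\
    incl (map (eval M v) (subterms (snd e))) V).
  { intros e He. split; intros x Hx; apply in_map_iff in Hx as (t & <- & Ht);
      apply in_or_app; left; apply in_map; right; apply in_flat_map; exists e;
      (split; [exact He | apply in_or_app; auto]). }
  destruct (V_terms _ (or_introl eq_refl)) as [Vs Vt].
  assert (In (eval M v (fst (conclusion q))) V) by (apply Vs, in_map, in_subterms).
  assert (In (eval M v (snd (conclusion q))) V) by (apply Vt, in_map, in_subterms).
  assert (V_top : In top V) by now left.
  assert (Hemb : exists (N : mgs_algebra) (h : M -> N),
    (is_functional N /\ Finite N /\ has_fixed_point N) /\
    (forall t, incl (map (eval M v) (subterms t)) V ->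
      eval N (fun n => h (v n)) t = h (eval M v t)) /\
    h (eval M v (fst (conclusion q))) <> h (eval M v (snd (conclusion q)))).
  { assert (V_inv : forall x, In x V -> In (inv x) V).
    { intros x Hx. apply (Permutation_in _ V_sym). now apply in_map. }
    (* The two sides of the conclusion differ, so one of the two inequalities fails, and its failure
       is enough to separate them. *)
    destruct (classic (le (eval M v (fst (conclusion q))) (eval M v (snd (conclusion q)))))
      as [Hle|Hle].
    - destruct (exists_partial_embedding M V (eval M v (snd (conclusion q)))
        (eval M v (fst (conclusion q)))) as
        (N & h & HN & Ej & Em & Ei & En & Ea & E0 & E1 & Hne); auto.
      { intros Hge. apply Hn. now apply (le_antisym M gsM). }
      exists N, h. split; [exact HN | split; [| auto]].
      apply eval_partial_embedding; auto. apply functional_cmgs, HN.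
    - destruct (exists_partial_embedding M V (eval M v (fst (conclusion q)))
        (eval M v (snd (conclusion q)))) as
        (N & h & HN & Ej & Em & Ei & En & Ea & E0 & E1 & Hne); auto.
      exists N, h. split; [exact HN | split; [| exact Hne]].
      apply eval_partial_embedding; auto. apply functional_cmgs, HN. }
  destruct Hemb as (N & h & HN & He & Hne). apply Hne.
  rewrite <- !He by assumption.
  apply (Hq N HN). intros e Hin. unfold holds_at.
  destruct (V_terms e (or_intror Hin)). rewrite !He by assumption.
  f_equal. now apply Hv.
Qed.

(** * The axioms as quasi-identities *)

Section Axiomatizability.
Variable M : mgs_algebra.
Hypothesis M_quasi : forall q, (forall N, is_cmgs N -> satisfies N q) -> satisfies M q.

Definition valuation (x y z : M) (n : nat) : M :=
  match n with 0%nat => x | 1%nat => y | _ => z end.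

Lemma identity_transfer (s t : term) :
  (forall N v, is_cmgs N -> eval N v s = eval N v t) ->
  forall x y z : M, eval M (valuation x y z) s = eval M (valuation x y z) t.
Proof.
  intros H x y z. apply (M_quasi (QuasiIdentity [] (s, t))).
  - intros N HN v _. now apply H.
  - intros e [].
Qed.

Lemma implication_transfer (s t s' t' : term) :
  (forall N v, is_cmgs N -> eval N v s = eval N v t -> eval N v s' = eval N v t') ->
  forall x y z : M, eval M (valuation x y z) s = eval M (valuation x y z) t ->
  eval M (valuation x y z) s' = eval M (valuation x y z) t'.
Proof.
  intros H x y z E. apply (M_quasi (QuasiIdentity [(s, t)] (s', t'))).
  - intros N HN v Hv. apply H; [exact HN|]. exact (Hv _ (or_introl eq_refl)).
  - intros e [<-|[]]. exact E.
Qed.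

(** Since [le x y] is an equation, each axiom is an identity in at most three variables, except
    residuation, which splits into two implications between equations. *)
Lemma cmgs_of_quasi_identities : is_cmgs M.
Proof.
  pose proof cmgs_mgs as S.
  pose proof (fun (N : mgs_algebra) (H : is_cmgs N) => mgs_gs N (S N H)) as G.
  pose proof (fun (N : mgs_algebra) (H : is_cmgs N) => gs_godel N (G N H)) as P.
  pose proof (fun (N : mgs_algebra) (H : is_cmgs N) => gs_de_morgan N (G N H)) as D.
  pose proof (fun (N : mgs_algebra) (H : is_cmgs N) => godel_heyting N (P N H)) as Y.
  pose proof (fun (N : mgs_algebra) (H : is_cmgs N) => heyting_lattice N (Y N H)) as B.
  pose proof (fun (N : mgs_algebra) (H : is_cmgs N) => bounded_lattice N (B N H)) as L.
  set (x := Var 0). set (y := Var 1). set (z := Var 2).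
  assert (bounded : is_bounded_lattice M).
  { split; [split | |].
    - intros a b. exact (identity_transfer (Join x y) (Join y x)
        (fun N v H => joinC N (L N H) (v 0%nat) (v 1%nat)) a b b).
    - intros a b. exact (identity_transfer (Meet x y) (Meet y x)
        (fun N v H => meetC N (L N H) (v 0%nat) (v 1%nat)) a b b).
    - intros a b c. exact (identity_transfer (Join x (Join y z)) (Join (Join x y) z)
        (fun N v H => joinA N (L N H) (v 0%nat) (v 1%nat) (v 2%nat)) a b c).
    - intros a b c. exact (identity_transfer (Meet x (Meet y z)) (Meet (Meet x y) z)
        (fun N v H => meetA N (L N H) (v 0%nat) (v 1%nat) (v 2%nat)) a b c).
    - intros a b. exact (identity_transfer (Meet x (Join x y)) x
        (fun N v H => joinK N (L N H) (v 0%nat) (v 1%nat)) a b b).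
    - intros a b. exact (identity_transfer (Join x (Meet x y)) x
        (fun N v H => meetK N (L N H) (v 0%nat) (v 1%nat)) a b b).
    - intros a. exact (identity_transfer (Meet Bot x) Bot
        (fun N v H => bot_le N (B N H) (v 0%nat)) a a a).
    - intros a. exact (identity_transfer (Meet x Top) x
        (fun N v H => le_top N (B N H) (v 0%nat)) a a a). }
  split; [split; [split; [split; [split; [exact bounded|] |] |
                          split; [exact bounded | | |] |] | | | | |] |].
  - intros a b c. split.
    + exact (implication_transfer (Meet (Meet x y) z) (Meet x y) (Meet x (Imp y z)) x
        (fun N v H => proj1 (residuation N (Y N H) (v 0%nat) (v 1%nat) (v 2%nat))) a b c).
    + exact (implication_transfer (Meet x (Imp y z)) x (Meet (Meet x y) z) (Meet x y)
        (fun N v H => proj2 (residuation N (Y N H) (v 0%nat) (v 1%nat) (v 2%nat))) a b c).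
  - intros a b. exact (identity_transfer (Join (Imp x y) (Imp y x)) Top
      (fun N v H => prelinearity N (P N H) (v 0%nat) (v 1%nat)) a b b).
  - intros a b c. exact (identity_transfer
      (Meet x (Join y z)) (Join (Meet x y) (Meet x z))
      (fun N v H => meet_joinDr N (D N H) (v 0%nat) (v 1%nat) (v 2%nat)) a b c).
  - intros a. exact (identity_transfer (Inv (Inv x)) x
      (fun N v H => invK N (D N H) (v 0%nat)) a a a).
  - intros a b. exact (identity_transfer (Inv (Meet x y)) (Join (Inv x) (Inv y))
      (fun N v H => inv_meet N (D N H) (v 0%nat) (v 1%nat)) a b b).
  - intros a. exact (identity_transfer (Meet (Imp x Bot) (Inv x)) (Imp x Bot)
      (fun N v H => neg_le_inv N (G N H) (v 0%nat)) a a a).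
  - intros a. exact (identity_transfer (Imp (All x) x) Top
      (fun N v H => M1 N (S N H) (v 0%nat)) a a a).
  - intros a b. exact (identity_transfer (All (Imp x (All y))) (Imp (Ex x) (All y))
      (fun N v H => M2 N (S N H) (v 0%nat) (v 1%nat)) a b b).
  - intros a b. exact (identity_transfer (All (Imp (All x) y)) (Imp (All x) (All y))
      (fun N v H => M3 N (S N H) (v 0%nat) (v 1%nat)) a b b).
  - intros a b. exact (identity_transfer (All (Join (Ex x) y)) (Join (Ex x) (All y))
      (fun N v H => M4 N (S N H) (v 0%nat) (v 1%nat)) a b b).
  - intros a. exact (identity_transfer (All x) (Inv (Ex (Inv x)))
      (fun N v H => MQ N (S N H) (v 0%nat)) a a a).
  - intros a. exact (identity_transfer
      (Meet (Ex (Meet x (Inv x))) (All (Join x (Inv x)))) (Ex (Meet x (Inv x)))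
      (fun N v H => MC N H (v 0%nat)) a a a).
Qed.

End Axiomatizability.

Theorem corollary5p6 :
  generated_as_quasivariety_by is_cmgs
    (fun M => is_functional M /\ Finite M /\ has_fixed_point M).
Proof.
  split.
  - intros M [H _]. now apply functional_cmgs.
  - intros M. split.
    + intros HM q Hq. now apply quasi_identity_of_finite.
    (* A quasi-identity valid throughout the class holds in the generators, which belong to it, and
       therefore in [M]. *)
    + intros H. apply cmgs_of_quasi_identities. intros q Hq. apply H.
      intros N [HN _]. now apply Hq, functional_cmgs.
Qed.
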